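(* Let $m\in\mathbb{N}$ be squarefree, $K=\mathbb{Q}(\sqrt{-m})\subset\mathbb{C}$, with discriminant $d_K$ and ring of integers $\mathcal{O}_K$. Let $\Gamma_K=SL_2(\mathcal{O}_K)$ and let $\Gamma_K^*$ be the maximal discrete extension of $\Gamma_K$ in $SL_2(\mathbb{C})$, i.e. the (unique) maximal discrete subgroup of $SL_2(\mathbb{C})$ containing $\Gamma_K$. Put $\omega=m+\sqrt{-m}$. For each squarefree positive divisor $d$ of $d_K$ one has $\gcd(d,\omega\overline{\omega}/d)=1$, so there exist $u,v\in\mathbb{Z}$ with $ud-v\,\omega\overline{\omega}/d=1$; set \[ V_d=\frac{1}{\sqrt{d}}\begin{pmatrix} ud & v\omega\\ \overline{\omega} & d\end{pmatrix}\in SL_2(\mathbb{C}), \] where $\sqrt{d}>0$. (The coset $\Gamma_K V_d$ does not depend on the choice of $u,v$.) Then \[ \Gamma_K^*=\bigcup_{d\mid d_K,\ d\ \text{squarefree}}\Gamma_K V_d , \] the union being over the squarefree positive divisors $d$ of $d_K$.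
   Context: $d_K=-m$ if $m\equiv 3\pmod 4$ and $d_K=-4m$ if $m\equiv 1,2\pmod 4$; correspondingly $\mathcal{O}_K=\mathbb{Z}+\mathbb{Z}(1+\sqrt{-m})/2$ or $\mathcal{O}_K=\mathbb{Z}+\mathbb{Z}\sqrt{-m}$. Here $\overline{\omega}$ is the complex conjugate of $\omega$, so $\omega\overline{\omega}=m^2+m$. *)

(* Defs.v *)
From HB Require Import structures.
From mathcomp Require Import all_boot all_order all_algebra all_field.
From mathcomp Require Import mathcomp_extra boolp classical_sets reals.
From mathcomp Require Import topology normedtype.
From mathcomp.real_closed Require Import complex.
From mathcomp Require Import ring zify.

Set Implicit Arguments.
Unset Strict Implicit.
Unset Printing Implicit Defensive.

Import Order.TTheory GRing.Theory Num.Theory.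
Import numFieldNormedType.Exports.

Local Open Scope classical_set_scope.
Local Open Scope ring_scope.
Local Open Scope complex_scope.

(* The usual topology of the complex plane, given by the modulus; matrices over
   R[i] then carry the entrywise (product) topology. *)
HB.instance Definition _ (R : realType) := PseudoPointedMetric.copy R[i] R[i]^o.

(* This excludes n = 0, since 0 ^ 2 divides 0. *)
Definition squarefree (n : nat) : Prop :=
  forall k : nat, (k ^ 2 %| n)%N -> k = 1%N.

Definition discK (m : nat) : int :=
  if (m %% 4 == 3)%N then - m%:Z else - (4 * m)%:Z.

Definition sqf_divisors (n : int) : set nat :=
  [set d : nat | (d%:Z %| n)%Z /\ squarefree d].

Section QuadraticField.
Variables (R : realType) (m : nat).
Local Notation C := R[i].

Definition sqrtN : C := 0 +i* Num.sqrt m%:R.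

Definition quad_field : set C :=
  [set z | exists a b : rat, z = ratr a + ratr b * sqrtN].

Definition ring_of_integers : set C :=
  [set z | quad_field z /\ integralOver (intr : int -> C) z].

Definition omega : C := m%:R + sqrtN.

Lemma sqrtN2 : sqrtN ^+ 2 = - m%:R.
Proof.
rewrite /sqrtN expr2; simpc; rewrite -expr2 sqr_sqrtr ?ler0n //.
by rewrite -(rmorph_nat (real_complex R) m) -rmorphN.
Qed.

Lemma conj_sqrtN : conjc sqrtN = - sqrtN.
Proof. by rewrite /sqrtN; simpc. Qed.

Lemma omega_norm : omega * conjc omega = (m ^ 2 + m)%:R.
Proof.
have -> : conjc omega = m%:R - sqrtN.
  by rewrite /omega /sqrtN -(rmorph_nat (real_complex R)) /=; simpc.
by rewrite mulrC /omega -subr_sqr sqrtN2 opprK natrD natrX.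
Qed.

End QuadraticField.

Lemma integral_ratr (F : numFieldType) (a : rat) :
  integralOver (intr : int -> F) (ratr a) -> exists n : int, a = n%:~R.
Proof.
case=> p mon_p /rootP pa0.
have pa : root (map_poly intr p : {poly rat}) a.
  apply/rootP/(fmorph_inj (ratr : {rmorphism rat -> F})).
  rewrite rmorph0 -horner_map -map_poly_comp -[RHS]pa0; congr horner.
  by apply: eq_map_poly => n; rewrite /= ratr_int.
have : (ratr a : algC) \in Num.int.
  apply: Cint_rat_Aint; first exact: Crat_rat.
  apply: (@root_monic_Aint (map_poly intr p)); last 1 first.
  - by apply/polyOverP=> i; rewrite coef_map /= intr_int.
  - have <- : map_poly (ratr : rat -> algC) (map_poly (intr : int -> rat) p) = map_poly intr p.
      by rewrite -map_poly_comp; apply: eq_map_poly => n; rewrite /= ratr_int.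
    by rewrite fmorph_root.
  - by rewrite monic_map.
case/intrP => n an; exists n; apply: (fmorph_inj (ratr : {rmorphism rat -> algC})).
by rewrite /= an ratr_int.
Qed.

Lemma sqf_denom (m : nat) (x : rat) (k : int) :
  squarefree m ->
  m%:R * x ^+ 2 = k%:~R -> exists n : int, x = n%:~R.
Proof.
move=> hm e.
have q0 : (denq x)%:~R != 0 :> rat by rewrite intr_eq0 denq_eq0.
have e2 : m%:Z * numq x ^+ 2 = k * denq x ^+ 2.
  apply: (@intr_inj rat); rewrite !expr2 !intrM -e.
  move: q0 (divq_num_den x); set p := numq x; set q := denq x => q0 <-.
  rewrite -pmulrn; field.
  exact: q0.
have e3 : (m * `|numq x| ^ 2 = `|k| * `|denq x| ^ 2)%N.
  by have /(congr1 absz) := e2; rewrite !expr2 !abszM absz_nat !mulnn.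
have : (`|denq x| ^ 2 %| m)%N.
  rewrite -(@Gauss_dvdl _ _ (`|numq x| ^ 2)%N); first by rewrite e3 dvdn_mull.
  by rewrite coprimeXl // coprimeXr // coprime_sym coprime_num_den.
move/hm => d1; exists (numq x).
rewrite -{1}(divq_num_den x).
have -> : denq x = 1 by rewrite -absz_denq d1.
by rewrite divr1.
Qed.

Lemma integral_sqrtN (R : realType) (m : nat) :
  integralOver (intr : int -> R[i]) (sqrtN R m).
Proof.
exists ('X^2 + (m%:Z)%:P); first by rewrite monicXnaddC.
apply/rootP; rewrite rmorphD /= map_polyXn map_polyC /= !hornerE sqrtN2.
by rewrite -pmulrn addNr.
Qed.

Lemma ring_of_integersE (R : realType) (m : nat) (hm : squarefree m) :
  ring_of_integers m = [set z : R[i] | exists a b : int,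
    z = a%:~R + b%:~R *
        (if (m %% 4 == 3)%N then (1 + sqrtN R m) / 2 else sqrtN R m)].
Proof.
pose s := sqrtN R m.
have iR (n : int) : integralOver (intr : int -> R[i]) n%:~R by exact: integral_id.
apply/seteqP; split => z /=; last first.
  case=> a [b ->]; case: ifP => m4; last first.
    split; first by exists a%:~R, b%:~R; rewrite !ratr_int.
    by apply: integral_add => //; apply: integral_mul => //; apply: integral_sqrtN.
  split.
    exists (a%:~R + b%:~R / 2), (b%:~R / 2).
    rewrite !(rmorphD, rmorphM, fmorphV) /= !ratr_int.
    by field.
  apply: integral_add => //; apply: integral_mul => //.
  exists ('X^2 - 'X + ((m.+1 %/ 4)%N%:Z)%:P).
    rewrite monicE -addrA lead_coefDl ?lead_coefXn // size_polyXn.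
    by rewrite (leq_ltn_trans (size_polyD _ _)) // gtn_max size_polyN size_polyX (leq_ltn_trans (size_polyC_leq1 _)).
  apply/rootP; rewrite rmorphD rmorphB /= map_polyXn map_polyX map_polyC /= !hornerE.
  have e : (m%:R : R[i]) = 4 * (m.+1 %/ 4)%:R - 1.
    have {1}-> : m = (4 * (m.+1 %/ 4) - 1)%N by lia.
    by rewrite natrB ?natrM //; lia.
  rewrite -pmulrn.
  have s2 : s ^+ 2 = 1 - 4 * (m.+1 %/ 4)%:R by rewrite sqrtN2 e opprB.
  have -> : ((1 + sqrtN R m) / 2) ^+ 2 - (1 + sqrtN R m) / 2 + (m.+1 %/ 4)%:R =
    (s ^+ 2 - 1) / 4 + (m.+1 %/ 4)%:R by rewrite /s; field.
  by rewrite s2; field.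
case=> [[a [b ->]] iz].
have iz' : integralOver (intr : int -> R[i]) (ratr a - ratr b * s).
  case: iz => p mp /rootP pz; exists p => //; apply/rootP.
  have cr (q : rat) : conjc (ratr q : R[i]) = ratr q.
    exact: (fmorph_eq_rat (conjc \o (ratr : rat -> R[i]) : {rmorphism rat -> R[i]})).
  have -> : ratr a - ratr b * s = (conjc : {rmorphism R[i] -> R[i]}) (ratr a + ratr b * s).
    by rewrite rmorphD (rmorphM _ (ratr b) s) [X in _ = X + _]cr [X in _ = _ + X * _]cr [X in _ = _ + _ * X]conj_sqrtN mulrN.
  have -> : map_poly (intr : int -> R[i]) p = map_poly conjc (map_poly intr p).
    by rewrite -map_poly_comp; apply: eq_map_poly => n; rewrite /= rmorph_int.
  by rewrite horner_map pz rmorph0.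
have [n en] : exists n : int, a *+ 2 = n%:~R.
  apply: (@integral_ratr R[i]); have := integral_add iz iz'.
  by congr integralOver; rewrite rmorphMn /= /s; ring.
have [k ek] : exists k : int, a ^+ 2 + m%:R * b ^+ 2 = k%:~R.
  apply: (@integral_ratr R[i]); have := integral_mul iz iz'.
  congr integralOver; rewrite -/s mulrC -subr_sqr [X in _ - X](exprMn 2 (ratr b) s) sqrtN2.
  by rewrite rmorphD rmorphM !rmorphXn /= ratr_nat; ring.
have [l el] : exists l : int, b *+ 2 = l%:~R.
  apply: (@sqf_denom m _ (4 * k - n ^+ 2)) => //.
  by rewrite rmorphB rmorphM rmorphXn /= -ek -en; ring.
have e4 : n * n + m%:Z * (l * l) = 4 * k.
  apply: (@intr_inj rat); rewrite rmorphD !rmorphM /= -en -el -ek -pmulrn; ring.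
have ea : ratr a = n%:~R / 2 :> R[i].
  by rewrite -(ratr_int _ n) -en rmorphMn /=; field.
have eb : ratr b = l%:~R / 2 :> R[i].
  by rewrite -(ratr_int _ l) -el rmorphMn /=; field.
rewrite ea eb.
have m4 : (m %% 4 != 0)%N.
  by apply/negP => /eqP m40; have := hm 2%N; rewrite /dvdn m40 => /(_ erefl).
have par (x : int) : exists y : int, x = 2 * y \/ x = 2 * y + 1.
  by exists (x %/ 2)%Z; lia.
have [q mq] : exists q : int, m%:Z = 4 * q + (m %% 4)%N%:Z.
  by exists (m %/ 4)%N; lia.
rewrite mq in e4.
have [[n' en'] [l' el']] := (par n, par l).
case: ifP => c.
  have [j nl] : exists j : int, n = 2 * j + l.
    exists (n' - l'); rewrite (eqP c) in e4.
    by case: en' el' => en' [] el'; rewrite en' el' in e4 *; lia.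
  by exists j, l; rewrite nl rmorphD rmorphM /= /s; field.
have [j [h [nj lh]]] : exists j h : int, n = 2 * j /\ l = 2 * h.
  exists n', l'.
  have r12 : (m %% 4 = 1)%N \/ (m %% 4 = 2)%N by lia.
  by case: en' el' r12 => en' [] el' [] r; rewrite en' el' r in e4 *; lia.
by exists j, h; rewrite nj lh !rmorphM /= /s; field.
Qed.

Section SL2.
Variable R : realType.
Local Notation C := R[i].

Definition mx2 (a b c d : C) : 'M[C]_2 :=
  \matrix_(i, j) if i == 0 then (if j == 0 then a else b)
                 else (if j == 0 then c else d).

Definition SL2 : set 'M[C]_2 := [set A | \det A = 1].

Record SL2_subgroup (G : set 'M[C]_2) : Prop := SL2Subgroup {
  subgroup_SL2 : G `<=` SL2;
  subgroup_1 : G 1%:M;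
  subgroup_mul : forall A B, G A -> G B -> G (A *m B);
  subgroup_inv : forall A, G A -> G (invmx A) }.

(* Discreteness in the subspace topology: every point of G is isolated in G. *)
Definition discrete_subgroup (G : set 'M[C]_2) : Prop :=
  SL2_subgroup G /\ G `<=` isolated G.

Definition maximal_discrete_extension (H G : set 'M[C]_2) : Prop :=
  [/\ discrete_subgroup G, H `<=` G &
      forall G', discrete_subgroup G' -> G `<=` G' -> G' = G].

Definition rcoset (H : set 'M[C]_2) (V : 'M[C]_2) : set 'M[C]_2 :=
  [set A *m V | A in H].

Definition GammaK (m : nat) : set 'M[C]_2 :=
  [set A | SL2 A /\ forall i j, ring_of_integers m (A i j)].

(* u d - v (omega (conjc omega) / d) = 1, where omega (conjc omega) = m ^ 2 + m by
   omega_norm; the quotient is exact for the d to which this is applied. *)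
Definition bezout (m d : nat) (u v : int) : Prop :=
  u * d%:Z - v * ((m ^ 2 + m) %/ d)%N%:Z = 1.

Definition Vd (m d : nat) (u v : int) : 'M[C]_2 :=
  ((Num.sqrt d%:R)%:C)^-1 *:
    mx2 (u%:~R * d%:R) (v%:~R * omega R m) (conjc (omega R m)) d%:R.

End SL2.

(* Main.v *)
(* Let [E] be the group of all [g] in [SL2] whose pairwise products of entries lie
   in [O].  It is discrete, since those products determine [g] up to sign.

   Every discrete [G] containing [GammaK] lies in [E].  By Shimizu's lemma the
   lower-left entry [c] of an element of [G] satisfies [c = 0] or [|c| >= 1];
   applied to conjugates of the parabolic elements of [GammaK], this bounds below
   the nonzero elements of the [O]-modules spanned by the two rows of any [g] in
   [G].  As [\det g = 1], a pigeonhole argument gives one [Q] such that [Q x y] is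
   in [O] for all entries [x], [y] of all [g] in [G].  Since [- c ^ 2] is again a
   lower-left entry (of [g T g^-1] with [T] the unit translation), all
   [Q c ^ (2 ^ n)] are in [O], so [c ^ 2] is integral.  Hence [E] is the unique
   maximal discrete extension.

   Finally, for [g] in [E] the numbers [|x| ^ 2] are rational integers, which gives
   a squarefree [d] with [sqrt d g] defined over [K]; its prime factors ramify, and
   two elements of [E] with the same [d] differ by an element of [GammaK]. *)

Require Import Defs.
From HB Require Import structures.
From mathcomp Require Import all_boot all_order all_algebra.
From mathcomp Require Import mathcomp_extra boolp classical_sets reals.
From mathcomp Require Import topology normedtype sequences.
From mathcomp.real_closed Require Import complex.
From mathcomp Require Import ring lra zify.

Set Implicit Arguments.
Unset Strict Implicit.
Unset Printing Implicit Defensive.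

Import Order.TTheory GRing.Theory Num.Theory.
Import numFieldNormedType.Exports.

Local Open Scope classical_set_scope.
Local Open Scope ring_scope.

Local Notation Re := complex.Re.
Local Notation Im := complex.Im.

(** * Real-valued modulus and conjugation on the complex numbers *)

Section Modulus.
Variable R : realType.
Local Notation C := R[i].
Implicit Types z w : C.

Definition modc z : R := Normc.normc z.

Lemma modcM z w : modc (z * w) = modc z * modc w.
Proof. exact: Normc.normcM. Qed.

Lemma modcD z w : modc (z + w) <= modc z + modc w.
Proof. exact: le_normcD. Qed.

Lemma modcN z : modc (- z) = modc z.
Proof. exact: normcN. Qed.

Lemma modc_ge0 z : 0 <= modc z.
Proof. by case: z => a b; exact: sqrtr_ge0. Qed.

Lemma modc0 : modc 0 = 0.
Proof. exact: Normc.normc0. Qed.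

Lemma modc1 : modc 1 = 1.
Proof. exact: Normc.normc1. Qed.

Lemma modc_eq0 z : (modc z == 0) = (z == 0).
Proof.
by apply/eqP/eqP => [/Normc.eq0_normc //|->]; exact: Normc.normc0.
Qed.

Lemma modc_gt0 z : (0 < modc z) = (z != 0).
Proof. by rewrite lt_def modc_ge0 andbT modc_eq0. Qed.

Lemma modcV z : modc z^-1 = (modc z)^-1.
Proof. exact: Normc.normcV. Qed.

Lemma modcX z n : modc (z ^+ n) = modc z ^+ n.
Proof. by elim: n => [|n IH]; rewrite ?modc1 // !exprS modcM IH. Qed.

Lemma modc_sq z : (modc z ^+ 2)%:C%C = z * conjc z.
Proof.
case: z => a b; rewrite /modc /= sqr_sqrtr ?addr_ge0 ?sqr_ge0 //.
by apply/eqP; rewrite eq_complex /=; apply/andP; split; apply/eqP; ring.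
Qed.

Lemma modc_sqE z : modc z ^+ 2 = Re z ^+ 2 + Im z ^+ 2.
Proof. by case: z => a b; rewrite /modc /= sqr_sqrtr ?addr_ge0 ?sqr_ge0. Qed.

Lemma modc_real (x : R) : 0 <= x -> modc x%:C%C = x.
Proof.
by move=> x0; rewrite /modc /= expr0n addr0 sqrtr_sqr ger0_norm.
Qed.

Lemma modc_nat n : modc n%:R = n%:R.
Proof. by rewrite -(rmorph_nat (real_complex R)) modc_real. Qed.

Lemma normr_modc z : `|z| = (modc z)%:C%C.
Proof. by rewrite normc_def; case: z. Qed.

Lemma Re_le_modc z : `|Re z| <= modc z.
Proof. by rewrite -lecR -normr_modc normc_ge_Re. Qed.

Lemma Im_le_modc z : `|Im z| <= modc z.
Proof.
rewrite -(ler_sqr (_ : `|Im z| \is Num.nneg)) ?nnegrE ?modc_ge0 //.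
by rewrite modc_sqE real_normK ?num_real // lerDr sqr_ge0.
Qed.

Lemma conjc_int (n : int) : conjc (n%:~R : C) = n%:~R.
Proof. exact: (rmorph_int (conjc : {rmorphism C -> C})). Qed.

Lemma conjcD z w : conjc (z + w) = conjc z + conjc w.
Proof. exact: (rmorphD (conjc : {rmorphism C -> C})). Qed.

Lemma conjcM z w : conjc (z * w) = conjc z * conjc w.
Proof. exact: (rmorphM (conjc : {rmorphism C -> C})). Qed.

Lemma conjcN z : conjc (- z) = - conjc z.
Proof. exact: (rmorphN (conjc : {rmorphism C -> C})). Qed.

Lemma conjc_ratr (q : rat) : conjc (ratr q : C) = ratr q.
Proof.
exact: (fmorph_eq_rat (conjc \o (ratr : rat -> C) : {rmorphism rat -> C})).
Qed.

End Modulus.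

(** * Arithmetic of the field [K] and its ring of integers [O] *)

Section Integers.
Variables (R : realType) (m : nat).
Hypothesis hm : squarefree m.
Local Notation C := R[i].
Local Notation K := (@quad_field R m).
Local Notation O := (@ring_of_integers R m).
Local Notation s := (sqrtN R m).
Implicit Types x y z : C.

Lemma squarefree_gt0 n : squarefree n -> (0 < n)%N.
Proof. by case: n => // /(_ 0%N) /(_ (dvdnn 0)). Qed.

Lemma quad_field_int (n : int) : K n%:~R.
Proof. by exists n%:~R, 0; rewrite ratr_int rmorph0 mul0r addr0. Qed.

Lemma quad_field_nat (n : nat) : K n%:R.
Proof. exact: (quad_field_int n). Qed.

Lemma quad_field_sqrtN : K s.
Proof. by exists 0, 1; rewrite rmorph0 rmorph1 mul1r add0r. Qed.

Lemma quad_fieldD x y : K x -> K y -> K (x + y).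
Proof.
move=> [a [b ->]] [c [d ->]]; exists (a + c), (b + d).
by rewrite !rmorphD /=; ring.
Qed.

Lemma quad_fieldN x : K x -> K (- x).
Proof.
by move=> [a [b ->]]; exists (- a), (- b); rewrite !rmorphN /=; ring.
Qed.

Lemma quad_fieldM x y : K x -> K y -> K (x * y).
Proof.
move=> [a [b ->]] [c [d ->]]; exists (a * c - m%:R * (b * d)), (a * d + b * c).
rewrite !rmorphD !rmorphN !rmorphM /= ratr_nat.
have -> : (m%:R : C) = - s ^+ 2 by rewrite sqrtN2 opprK.
ring.
Qed.

Lemma conj_quad_field (a b : rat) :
  conjc (ratr a + ratr b * s) = ratr a - ratr b * s.
Proof.
by rewrite conjcD (conjcM (ratr b) s) !conjc_ratr conj_sqrtN mulrN.
Qed.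

Lemma quad_field_conj x : K x -> K (conjc x).
Proof.
move=> [a [b ->]]; exists a, (- b).
by rewrite conj_quad_field rmorphN mulNr.
Qed.

Lemma quad_fieldV x : K x -> K x^-1.
Proof.
have [->|x0] := eqVneq x 0; first by rewrite invr0.
move=> Kx; have := Kx => -[a [b ex]].
have e : x * conjc x = ratr (a ^+ 2 + m%:R * b ^+ 2).
  rewrite ex conj_quad_field.
  rewrite rmorphD rmorphM !rmorphXn /= ratr_nat.
  have -> : (m%:R : C) = - s ^+ 2 by rewrite sqrtN2 opprK.
  ring.
have -> : x^-1 = conjc x * ratr (a ^+ 2 + m%:R * b ^+ 2)^-1.
  rewrite (fmorphV (ratr : {rmorphism rat -> C})) /= -e.
  by field; rewrite conjc_eq0 x0.
apply: quad_fieldM (quad_field_conj Kx) _.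
by exists (a ^+ 2 + m%:R * b ^+ 2)^-1, 0; rewrite rmorph0 mul0r addr0.
Qed.

Lemma integers_int (n : int) : O n%:~R.
Proof. by split; [exact: quad_field_int | exact: integral_id]. Qed.

Lemma integers_nat (n : nat) : O n%:R.
Proof. exact: (integers_int n). Qed.

Lemma integers0 : O 0. Proof. exact: (integers_int 0). Qed.
Lemma integers1 : O 1. Proof. exact: (integers_int 1). Qed.

Lemma integersD x y : O x -> O y -> O (x + y).
Proof.
by move=> [Kx ix] [Ky iy]; split; [exact: quad_fieldD | exact: integral_add].
Qed.

Lemma integersN x : O x -> O (- x).
Proof.
by move=> [Kx ix]; split; [exact: quad_fieldN | exact: integral_opp].
Qed.

Lemma integersM x y : O x -> O y -> O (x * y).
Proof.
by move=> [Kx ix] [Ky iy]; split; [exact: quad_fieldM | exact: integral_mul].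
Qed.

Lemma integersX x n : O x -> O (x ^+ n).
Proof.
move=> Ox; elim: n => [|n IH]; first exact: integers1.
by rewrite exprS; exact: integersM.
Qed.

Lemma integers_sqrtN : O s.
Proof. by split; [exact: quad_field_sqrtN | exact: integral_sqrtN]. Qed.

Lemma integers_conj x : O x -> O (conjc x).
Proof.
move=> [Kx [p mp /rootP px]]; split; first exact: quad_field_conj.
exists p => //; apply/rootP.
have -> : map_poly (intr : int -> C) p = map_poly conjc (map_poly intr p).
  by rewrite -map_poly_comp; apply: eq_map_poly => n /=; rewrite conjc_int.
by rewrite horner_map px rmorph0.
Qed.

(** With [o = x ^+ j - x ^+ i], the monic polynomial X^j - X^i - o has integral coefficients and
    root [x], and integrality is transitive. *)
Lemma integers_pow_sub x i j : (i < j)%N -> K x -> O (x ^+ j - x ^+ i) -> O x.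
Proof.
move=> ij Kx [_ ixx]; split => //.
apply: (@integral_root_monic _ _ _ _ ('X^j - 'X^i - (x ^+ j - x ^+ i)%:P)).
- rewrite monicE -addrA lead_coefDl ?lead_coefXn // size_polyXn.
  rewrite (leq_ltn_trans (size_polyD _ _)) // gtn_max !size_polyN size_polyXn.
  by rewrite ltnS ij (leq_ltn_trans (size_polyC_leq1 _)) // ltnS (leq_ltn_trans _ ij).
- by apply/rootP; rewrite !hornerE subrr.
- apply/integral_poly => k; rewrite !coefB !coefXn coefC.
  apply: integral_sub; first by apply: integral_sub; exact: integral_nat.
  by case: ifP => // _; exact: integral0.
Qed.

Lemma integers_sqr x : K x -> O (x ^+ 2) -> O x.
Proof.
move=> Kx [_ i2]; split => //.
apply: (@integral_root_monic _ _ _ _ ('X^2 - (x ^+ 2)%:P)).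
- by rewrite monicXnsubC.
- by apply/rootP; rewrite !hornerE subrr.
- apply/integral_poly => k; rewrite !coefB !coefXn coefC.
  apply: integral_sub; first exact: integral_nat.
  by case: ifP => // _; exact: integral0.
Qed.

(** The recurring integrality test: entries of an extension need not lie in [K], but their squares
    are integers, so only membership of the product in [K] is left to check. *)
Lemma integers_mul_sqr x y :
  O (x ^+ 2) -> O (y ^+ 2) -> K (x * y) -> O (x * y).
Proof.
by move=> Ox Oy Kxy; apply: integers_sqr => //; rewrite exprMn; exact: integersM.
Qed.

(** With [t] and [n] the trace and norm of [w], a root of X^2 - t X + n of discriminant [discK m],
    later arguments avoid the case distinction on m mod 4. *)
Definition int_gen : C := if (m %% 4 == 3)%N then (1 + s) / 2 else s.
Definition gen_trace : int := if (m %% 4 == 3)%N then 1 else 0.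
Definition gen_norm : int := if (m %% 4 == 3)%N then (m.+1 %/ 4)%N%:Z else m%:Z.
Local Notation w := int_gen.
Local Notation t := gen_trace.
Local Notation n := gen_norm.

Lemma disc_gen : discK m = t ^+ 2 - 4 * n.
Proof. by rewrite /discK /t /n; case: ifP => ? //=; lia. Qed.

Lemma conj_int_gen : conjc w = t%:~R - w.
Proof.
rewrite /w /t; case: ifP => _; last by rewrite conj_sqrtN sub0r.
rewrite conjcM conjcD conj_sqrtN conjc1 conjc_inv conjc_nat.
by field.
Qed.

Lemma int_gen_sq : w ^+ 2 = t%:~R * w - n%:~R.
Proof.
rewrite /w /t /n; case: ifP => h; last first.
  by rewrite sqrtN2 mul0r sub0r -pmulrn.
have e : (m%:R : C) = 4 * (m.+1 %/ 4)%:R - 1.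
  have {1}-> : m = (4 * (m.+1 %/ 4) - 1)%N by lia.
  by rewrite natrB ?natrM //; lia.
rewrite mul1r -pmulrn.
transitivity ((1 + 2 * s + s ^+ 2) / 4); first by field.
by rewrite sqrtN2 e; field.
Qed.

Lemma int_gen_Im_gt0 : 0 < Im w.
Proof.
have sm : 0 < Num.sqrt (m%:R : R) by rewrite sqrtr_gt0 ltr0n squarefree_gt0.
rewrite /w; case: ifP => _ //.
suff -> : Im ((1 + s) / 2) = Num.sqrt m%:R / 2 by rewrite divr_gt0.
have -> : (1 + s) / 2 = ((1 / 2) +i* (Num.sqrt m%:R / 2))%C.
  apply: (@mulIf _ (2 : C)); first by rewrite pnatr_eq0.
  rewrite -mulrA mulVf ?pnatr_eq0 // mulr1 -(rmorph_nat (real_complex R) 2).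
  by apply/eqP; rewrite eq_complex /=; apply/andP; split; apply/eqP; field.
by [].
Qed.

Lemma integersP z : O z <-> exists a b : int, z = a%:~R + b%:~R * w.
Proof. by rewrite (ring_of_integersE R hm). Qed.

Lemma Im_intM (b : int) z : Im (b%:~R * z) = b%:~R * Im z.
Proof. by rewrite -(rmorph_int (real_complex R)) /=; case: z => u v /=; ring. Qed.

Lemma Im_int (b : int) : Im (b%:~R : C) = 0.
Proof. by rewrite -(rmorph_int (real_complex R)). Qed.

Lemma ImD z z' : Im (z + z') = Im z + Im z'.
Proof. by case: z z' => ? ? []. Qed.

Lemma int_gen_free (a b a' b' : int) :
  a%:~R + b%:~R * w = a'%:~R + b'%:~R * w -> a = a' /\ b = b'.
Proof.
move=> e.
have eb : b = b'.
  have := congr1 (@Im _) e; rewrite !ImD !Im_intM !Im_int !add0r.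
  by move/(mulIf (lt0r_neq0 int_gen_Im_gt0)) => /eqP; rewrite eqr_int => /eqP.
split=> //; move: e; rewrite eb => /addIr /eqP.
by rewrite eqr_int => /eqP.
Qed.

Lemma integers_trace z : O z -> exists k : int, z + conjc z = k%:~R.
Proof.
move/integersP => [a [b ->]]; exists (2 * a + b * t).
rewrite conjcD conjcM !conjc_int conj_int_gen.
by rewrite rmorphD !rmorphM /=; ring.
Qed.

Lemma integers_norm z : O z -> exists k : nat, z * conjc z = k%:R.
Proof.
move/integersP => [a [b ez]].
have [k ek] : exists k : int, z * conjc z = k%:~R.
  exists (a ^+ 2 + t * (a * b) + n * b ^+ 2).
  rewrite ez conjcD conjcM !conjc_int conj_int_gen.
  rewrite !rmorphD !rmorphM /=.
  transitivity (a%:~R ^+ 2 + a%:~R * b%:~R * t%:~R +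
    b%:~R ^+ 2 * (t%:~R * w - w ^+ 2)); first by ring.
  by rewrite int_gen_sq; ring.
have k0 : 0 <= k by rewrite -(ler0z R) -lecR rmorph_int -ek mulcJ_ge0.
by exists `|k|%N; rewrite ek -{1}(gez0_abs k0) -pmulrn.
Qed.

Lemma integers_modc z : O z -> exists k : nat, modc z ^+ 2 = k%:R.
Proof.
move=> /integers_norm[k ek]; exists k; apply: complexI.
by rewrite modc_sq ek rmorph_nat.
Qed.

Lemma integers_modc_ge1 z : O z -> z != 0 -> 1 <= modc z.
Proof.
move=> /integers_modc [k ek] z0.
rewrite -(ler_sqr (_ : 1 \is Num.nneg)) ?nnegrE ?modc_ge0 // ek expr1n ler1n.
by rewrite -(ltr0n R) -ek exprn_gt0 // modc_gt0.
Qed.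

(** Here [z] is a root of X^2 - k X + l. *)
Lemma integers_of_trace_norm z (k l : int) :
  K z -> z + conjc z = k%:~R -> z * conjc z = l%:~R -> O z.
Proof.
move=> Kz ek el; split => //.
exists ('X^2 - k%:P * 'X + l%:P).
  rewrite monicE -addrA lead_coefDl ?lead_coefXn // size_polyXn.
  rewrite (leq_ltn_trans (size_polyD _ _)) // gtn_max size_polyN.
  rewrite (leq_ltn_trans (size_polyC_leq1 _)) // andbT.
  rewrite (leq_ltn_trans (size_polyMleq _ _)) // size_polyX addn2 /= !ltnS.
  exact: size_polyC_leq1.
apply/rootP; rewrite rmorphD rmorphB /= map_polyXn rmorphM /= map_polyX.
by rewrite !map_polyC /= !hornerE -ek -el; ring.
Qed.

(* [1 + |w|] bounds the covering radius of the lattice [O] in [C]. *)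
Lemma integers_cover z : exists2 o, O o & modc (z - o) <= 1 + modc w.
Proof.
have h0 := int_gen_Im_gt0.
pose r := Im z / Im w; pose r' := Re z - r * Re w.
have ez : z = r'%:C%C + r%:C%C * w.
  apply/eqP; rewrite eq_complex /r' /r; case: (w) h0 => u v /= h0.
  by apply/andP; split; apply/eqP; [ring | field; rewrite gt_eqF].
exists ((Num.floor r')%:~R + (Num.floor r)%:~R * w).
  by apply/integersP; eexists; eexists.
have fl (x : R) : 0 <= x - (Num.floor x)%:~R <= 1.
  by have /andP[] := floor_itv x; rewrite rmorphD /= => ? ?; apply/andP; split; lra.
have /andP[a0 a1] := fl r; have /andP[b0 b1] := fl r'.
have -> : z - ((Num.floor r')%:~R + (Num.floor r)%:~R * w) =
   (r' - (Num.floor r')%:~R)%:C%C + (r - (Num.floor r)%:~R)%:C%C * w.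
  by rewrite {1}ez !rmorphB /= !rmorph_int; ring.
apply: le_trans (modcD _ _) _.
rewrite modcM !modc_real // lerD //.
by rewrite ler_piMl // modc_ge0.
Qed.

End Integers.

(** * Pigeonhole principle for bounded complex sequences *)

Lemma pigeonhole_nat (T : finType) (f : nat -> T) :
  exists i j, [/\ (i < j)%N, (j <= #|T|)%N & f i = f j].
Proof.
have : ~~ injectiveb (fun i : 'I_(#|T|.+1) => f i).
  apply/negP => /injectiveP /leq_card; rewrite card_ord.
  by rewrite ltnn.
case/injectivePn => i [j ij fij].
wlog lt_ij : i j ij fij / (i < j)%N.
  move=> W; have [lt|lt|e] := ltngtP i j; first exact: (W i j).
    by apply: (W j i); rewrite // eq_sym.
  by rewrite (val_inj e) eqxx in ij.
by exists i, j; split; rewrite // -ltnS.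
Qed.

Section Pigeonhole.
Variable R : realType.
Local Notation C := R[i].

(** The square of half-side [r] is cut into cells of side 1/4. Two points of one cell are at
    distance below sqrt 2 / 4 < 1/2. That [N] depends on [r] alone makes the later denominators
    uniform. *)
Lemma close_pair (r : R) : exists N : nat, forall f : nat -> C,
  (forall i, modc (f i) <= r) ->
  exists i j, [/\ (i < j)%N, (j <= N)%N & modc (f i - f j) < 2^-1].
Proof.
pose B := Num.bound (4 * r).
pose T := ('I_(2 * B).+1 * 'I_(2 * B).+1)%type.
exists #|{: T}| => f fr.
(* As 4 r < B, the floors lie between -B and B. The shift by B turns them into valid indices, so
   [inord] never falls back to its default. *)
pose cell (x : R) : 'I_(2 * B).+1 := inord (absz (Num.floor (4 * x) + B%:Z)).
have cellP (x y : R) : `|x| <= r -> `|y| <= r -> cell x = cell y ->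
    `|x - y| < 4^-1.
  have bnd (u : R) : `|u| <= r ->
      0 <= Num.floor (4 * u) + B%:Z /\ Num.floor (4 * u) + B%:Z <= (2 * B)%N%:Z.
    move=> ur; have r0 : 0 <= 4 * r by move: (normr_ge0 u) ur => ? ?; lra.
    have rB : 4 * r < B%:R.
      by have := archi_boundP r0.
    have /andP[u1 u2] : - r <= u <= r by rewrite -ler_norml.
    have /andP[f1 f2] := floor_itv (4 * u).
    have g1 : (- B%:Z)%:~R < (Num.floor (4 * u) + 1)%:~R :> R.
      by rewrite rmorphN /= -pmulrn; lra.
    have g2 : (Num.floor (4 * u))%:~R < (B%:Z)%:~R :> R.
      by rewrite -pmulrn; lra.
    by move: g1 g2; rewrite !ltr_int => ? ?; split; lia.
  move=> /bnd[x1 x2] /bnd[y1 y2] /(congr1 val); rewrite /= !inordK; last 2 first.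
  - by lia.
  - by lia.
  move=> e; have {}e : Num.floor (4 * x) = Num.floor (4 * y) by lia.
  have /andP[] := floor_itv (4 * x); have /andP[] := floor_itv (4 * y).
  rewrite e !rmorphD /= => *; rewrite ltr_norml; apply/andP; split; lra.
have [i [j [ij jN [e1 e2]]]] :=
  pigeonhole_nat (fun i => (cell (Re (f i)), cell (Im (f i))) : T).
exists i, j; split => //.
have c1 := cellP _ _ (le_trans (Re_le_modc _) (fr i)) (le_trans (Re_le_modc _) (fr j)) e1.
have c2 := cellP _ _ (le_trans (Im_le_modc _) (fr i)) (le_trans (Im_le_modc _) (fr j)) e2.
rewrite -(ltr_sqr (_ : modc _ \is Num.nneg)) ?nnegrE ?modc_ge0 ?invr_ge0 //.
rewrite modc_sqE.
have -> : Re (f i - f j) = Re (f i) - Re (f j) by case: (f i) (f j) => ? ? [].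
have -> : Im (f i - f j) = Im (f i) - Im (f j) by case: (f i) (f j) => ? ? [].
move: c1 c2; rewrite !ltr_norml => /andP[? ?] /andP[? ?]; nra.
Qed.

End Pigeonhole.

(** * Separated [O]-modules and bounded denominators *)

Section Lattices.
Variables (R : realType) (m : nat).
Hypothesis hm : squarefree m.
Local Notation C := R[i].
Local Notation O := (@ring_of_integers R m).

Record int_module (L : set C) : Prop := IntModule {
  int_moduleB : forall x y, L x -> L y -> L (x - y);
  int_moduleZ : forall a x, O a -> L x -> L (a * x) }.

Definition unit_separated (L : set C) := forall x, L x -> x != 0 -> 1 <= modc x.

Definition row_module (a b : C) : set C :=
  [set z | exists x y, [/\ O x, O y & z = x * a + y * b]].

Lemma row_moduleP a b : int_module (row_module a b).
Proof.
split=> [x y [u [v [Ou Ov ->]]] [u' [v' [Ou' Ov' ->]]] | o x Oo [u [v [Ou Ov ->]]]].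
  exists (u - u'), (v - v'); split; first exact/integersD/integersN.
    exact/integersD/integersN.
  ring.
exists (o * u), (o * v); split; [exact: integersM | exact: integersM | ring].
Qed.

Lemma row_module_l a b : row_module a b a.
Proof. by exists 1, 0; split; [exact: integers1 | exact: integers0 | ring]. Qed.

Lemma row_module_r a b : row_module a b b.
Proof. by exists 0, 1; split; [exact: integers0 | exact: integers1 | ring]. Qed.

(** Descent: an element failing the bound is replaced by one of less than half its modulus, which
    must stop since no nonzero modulus is below 1. Allowing the factor 2 avoids any compactness
    argument. *)
Lemma almost_shortest (L : set C) x : unit_separated L -> L x -> x != 0 ->
  exists e, [/\ L e, e != 0 & forall y, L y -> y != 0 -> modc e <= 2 * modc y].
Proof.
move=> sepL; have [n xn] : exists n, modc x < 2 ^+ n.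
  exists (Num.bound (modc x)); apply: lt_trans (archi_boundP (modc_ge0 _)) _.
  by rewrite -natrX ltr_nat ltn_expl.
elim: n x xn => [|n IH] x xn Lx x0.
  by have := lt_le_trans xn (sepL _ Lx x0); rewrite ltxx.
have [short|] := pselect (forall y, L y -> y != 0 -> modc x <= 2 * modc y).
  by exists x.
move=> /existsNP[y] /not_implyP[Ly] /not_implyP[y0] /negP; rewrite -ltNge => yx.
by apply: (IH y) => //; move: xn; rewrite exprS; lra.
Qed.

(** Each [i y / e] is within bounded distance of some [o i] in [O]. Two of these errors, with
    indices at most N, differ by some [u] with |u| < 1/2. Then [u e] lies in [L] and is too short to
    be nonzero, so [(j - i) y] is in [O e], and [j - i] divides N!, which does not depend on [L]. *)
Lemma commensurable_shortest : exists2 q : nat, (0 < q)%N &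
  forall (L : set C) e, int_module L -> L e -> e != 0 ->
    (forall y, L y -> y != 0 -> modc e <= 2 * modc y) ->
  forall y, L y -> exists2 o, O o & q%:R * y = o * e.
Proof.
have [N NP] := @close_pair R (1 + modc (int_gen R m)).
exists N`!; first exact: fact_gt0.
move=> L e modL Le e0 short y Ly.
have /choice[o oP] (i : nat) : exists o, O o /\
    modc (i%:R * y / e - o) <= 1 + modc (int_gen R m).
  by have [o] := integers_cover hm (i%:R * y / e); exists o.
have [i [j [ij jN fij]]] := NP _ (fun i => (oP i).2).
have Lnat k : L (k%:R * y) by apply: int_moduleZ => //; exact: integers_nat.
have e_ij : (j - i)%:R * y = (o j - o i) * e.
  set u := _ - _ in fij.
  have eu : u * e = (i%:R * y - j%:R * y) - (o i - o j) * e by rewrite /u; field.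
  have : u * e = 0.
    apply/eqP/negPn/negP => ue0.
    have : modc e <= 2 * modc (u * e).
      apply: short => //; rewrite eu.
      apply: (int_moduleB modL); first exact: (int_moduleB modL).
      by apply: (int_moduleZ modL) => //; apply: integersD (integersN _); case: (oP i) (oP j) => ? _ [].
    rewrite modcM; have : 0 < modc e by rewrite modc_gt0.
    by move: fij; move: (modc e) (modc u) => E U; clear => *; nra.
  rewrite eu => /eqP; rewrite subr_eq0 => /eqP eo.
  by rewrite natrB 1?ltnW // mulrBl -opprB eo; ring.
have /dvdnP[k ->] : ((j - i)%N %| N`!)%N.
  by apply: dvdn_fact; rewrite subn_gt0 ij (leq_trans (leq_subr _ _)).
exists (k%:R * (o j - o i)).
  apply: integersM (integers_nat _ _ _) _.
  by apply: integersD (integersN _); case: (oP i) (oP j) => ? _ [].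
by rewrite natrM -!mulrA e_ij.
Qed.

(* If [x] maps the first row into [O], then [x = (x a) d - (x b) c] lies in the
   module of the second row. *)
Lemma rows_bounded_denominator : exists2 Q : nat, (0 < Q)%N &
  forall a b c d, a * d - b * c = 1 ->
    unit_separated (row_module a b) -> unit_separated (row_module c d) ->
  forall x y, row_module a b x -> row_module c d y -> O (Q%:R * (x * y)).
Proof.
have [q q0 qP] := commensurable_shortest.
exists (q ^ 2 * (q ^ 4)`!)%N; first by rewrite muln_gt0 expn_gt0 q0 fact_gt0.
move=> a b c d det1 sep1 sep2 x y Lx Ly.
have nz1 : exists2 z, row_module a b z & z != 0.
  have [a0|] := eqVneq a 0; last by exists a => //; exact: row_module_l.
  exists b; first exact: row_module_r.
  by apply/eqP => b0; move/eqP: det1; rewrite a0 b0 !mul0r subr0 eq_sym oner_eq0.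
have nz2 : exists2 z, row_module c d z & z != 0.
  have [c0|] := eqVneq c 0; last by exists c => //; exact: row_module_l.
  exists d; first exact: row_module_r.
  by apply/eqP => d0; move/eqP: det1; rewrite c0 d0 !mulr0 subr0 eq_sym oner_eq0.
have [z1 Lz1 z10] := nz1; have [z2 Lz2 z20] := nz2.
have [e [Le e0 eshort]] := almost_shortest sep1 Lz1 z10.
have [f [Lf f0 fshort]] := almost_shortest sep2 Lz2 z20.
have qe := qP _ _ (row_moduleP a b) Le e0 eshort.
have qf := qP _ _ (row_moduleP c d) Lf f0 fshort.
have Lqe : row_module c d (q%:R / e).
  have [oa Oa ea] := qe _ (row_module_l a b).
  have [ob Ob eb] := qe _ (row_module_r a b).
  exists (- ob), oa; split => //; first exact: integersN.
  transitivity (q%:R / e * (a * d - b * c)); first by rewrite det1 mulr1.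
  transitivity ((q%:R * a) / e * d - (q%:R * b) / e * c); first by ring.
  by rewrite ea eb; field.
have [o Oo eo] := qf _ Lqe.
have q0C : (q%:R : C) != 0 by rewrite pnatr_eq0 -lt0n.
have o0 : o != 0.
  apply/eqP => o0; move/eqP: eo; rewrite o0 mul0r !mulf_eq0 invr_eq0.
  by rewrite (negPf e0) (negPf q0C).
have [k ek] := integers_norm hm Oo.
(* By [eo], q^2 = o e f with |e|, |f| >= 1, so |o| <= q^2. The norm [k] of [o] therefore divides the
   factorial in [Q], which clears the denominator of e f = q^2 / o. *)
have kq : (0 < k <= q ^ 4)%N.
  rewrite -(ltr0n R) -(ler_nat R).
  have -> : (k%:R : R) = modc o ^+ 2.
    by apply: complexI; rewrite modc_sq ek rmorph_nat.
  rewrite exprn_gt0 ?modc_gt0 //= natrX.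
  have -> : (q%:R : R) ^+ 4 = (q%:R ^+ 2) ^+ 2 by rewrite -exprM.
  rewrite ler_sqr ?nnegrE ?modc_ge0 ?exprn_ge0 //.
  have := congr1 (@modc R) eo; rewrite !modcM modcV !modc_nat => em.
  have e1 := sep1 _ Le e0; have f1 := sep2 _ Lf f0.
  have -> : (q%:R : R) ^+ 2 = modc o * modc f * modc e.
    by rewrite -em; field; rewrite modc_eq0.
  rewrite -mulrA ler_peMr ?modc_ge0 //.
  by rewrite -[leLHS]mul1r ler_pM.
have [ox Ox ex] := qe _ Lx; have [oy Oy ey] := qf _ Ly.
have /dvdnP[l el] : (k %| (q ^ 4)`!)%N by apply: dvdn_fact.
have kef : k%:R * (e * f) = q%:R ^+ 2 * conjc o.
  rewrite -ek; transitivity (conjc o * e * (o * f)); first by ring.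
  by rewrite -eo; field.
have -> : (q ^ 2 * (q ^ 4)`!)%N%:R * (x * y) =
    l%:R * (ox * (oy * (q%:R ^+ 2 * conjc o))).
  rewrite el -kef !natrM.
  transitivity (l%:R * k%:R * ((q%:R * x) * (q%:R * y))); first by ring.
  by rewrite ex ey; ring.
do !apply: integersM => //; rewrite ?expr2; do ?exact: integersM; do ?exact: integers_nat.
exact: integers_conj.
Qed.

End Lattices.

(** * Two-by-two matrices and their entrywise topology *)

Section Matrices2.
Variable R : realType.
Local Notation C := R[i].

Lemma mx2P (A : 'M[C]_2) : exists a b c d, A = mx2 a b c d.
Proof.
exists (A 0 0), (A 0 1), (A 1 0), (A 1 1); apply/matrixP => i j; rewrite !mxE.
by case: i => [[|[|//]] ?]; case: j => [[|[|//]] ?]; congr (A _ _); apply/val_inj.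
Qed.

Lemma mx2_mul (a b c d a' b' c' d' : C) :
  mx2 a b c d *m mx2 a' b' c' d' =
  mx2 (a * a' + b * c') (a * b' + b * d') (c * a' + d * c') (c * b' + d * d').
Proof.
apply/matrixP => i j; rewrite !mxE big_ord_recl big_ord1 !mxE /=.
by case: i => [[|[|//]] ?]; case: j => [[|[|//]] ?].
Qed.

Lemma det_mx2E (a b c d : C) : \det (mx2 a b c d) = a * d - b * c.
Proof.
rewrite (expand_det_row _ 0) big_ord_recl big_ord1 /cofactor !det_mx11 !mxE /=.
by rewrite expr0 expr1; ring.
Qed.

Lemma SL2_mx2 (a b c d : C) : a * d - b * c = 1 -> SL2 (mx2 a b c d).
Proof. by rewrite /SL2 /= det_mx2E. Qed.

Lemma SL2_entry_neq0 (A : 'M[C]_2) : SL2 A -> exists i j, A i j != 0.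
Proof.
move=> SA; apply/not_existsP => H0; suff A0 : A = 0.
  by move: SA; rewrite /SL2 /= A0 det0 => /eqP; rewrite eq_sym oner_eq0.
apply/matrixP => i j; rewrite mxE; apply/eqP/negPn/negP => nz.
by apply: (H0 i); exists j.
Qed.

Lemma mx2_1 : mx2 1 0 0 1 = 1%:M :> 'M[C]_2.
Proof.
apply/matrixP => i j; rewrite !mxE.
by case: i => [[|[|//]] ?]; case: j => [[|[|//]] ?].
Qed.

Lemma invmx_mx2 (a b c d : C) : a * d - b * c = 1 ->
  invmx (mx2 a b c d) = mx2 d (- b) (- c) a.
Proof.
move=> det1.
have AB : mx2 a b c d *m mx2 d (- b) (- c) a = 1%:M.
  by rewrite mx2_mul -mx2_1; congr mx2; rewrite -?det1; ring.
have [uA _] := mulmx1_unit AB.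
by rewrite -[RHS](mulKmx uA) AB mulmx1.
Qed.

Lemma nbhs_mxP (A : 'M[C]_2) (P : set 'M[C]_2) :
  nbhs A P <-> exists2 e : R, 0 < e &
    forall B : 'M[C]_2, (forall i j, modc (A i j - B i j) < e) -> P B.
Proof.
split=> [/nbhs_ballP[e /= e0 AP] | [e e0 AP]].
  (* The radius is an element of [C]; being positive, it is real. *)
  have eE : e = (Re e)%:C%C by rewrite RRe_real // gtr0_real.
  move: e0; rewrite eE ltcR => e0.
  exists (Re e) => // B AB; apply: AP; split => [|i j]; first by rewrite eE ltcR.
  by rewrite /ball /= eE normr_modc ltcR.
apply/nbhs_ballP; exists e%:C%C => /=; first by rewrite ltcR.
move=> B [_ AB]; apply: AP => i j.
by have := AB i j; rewrite /ball /= normr_modc ltcR.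
Qed.

Lemma isolatedP (G : set 'M[C]_2) A : G A ->
  isolated G A <-> exists2 e : R, 0 < e &
    forall B, G B -> (forall i j, modc (A i j - B i j) < e) -> B = A.
Proof.
move=> GA; split=> [[_ [V /nbhs_mxP[e e0 eV] VG]] | [e e0 eG]].
  exists e => // B GB /eV VB; suff : [set A] B by [].
  by rewrite -VG.
split; first by rewrite inE.
exists [set B : 'M[C]_2 | forall i j, modc (A i j - B i j) < e]; first by apply/nbhs_mxP; exists e.
apply/seteqP; split=> [B [/= AB GB] | B ->]; first exact: eG.
by split => //= i j; rewrite subrr modc0.
Qed.

End Matrices2.

(** * Shimizu's lemma *)

Section Shimizu.
Variable R : realType.
Local Notation C := R[i].
Local Notation T1 := (mx2 1 1 0 1 : 'M[C]_2).

Lemma conj_T1 (a b c d : C) : a * d - b * c = 1 ->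
  mx2 a b c d *m T1 *m invmx (mx2 a b c d) =
  mx2 (1 - a * c) (a ^+ 2) (- c ^+ 2) (1 + a * c).
Proof.
move=> det1; rewrite invmx_mx2 // !mx2_mul; congr mx2.
- by rewrite -[X in _ = X - _]det1; ring.
- by ring.
- by ring.
- by rewrite -[X in _ = X + _]det1; ring.
Qed.

Variable G : set 'M[C]_2.
Hypothesis (dG : discrete_subgroup G) (GT1 : G T1).

Lemma shimizu_step (a b c d : C) : G (mx2 a b c d) ->
  G (mx2 (1 - a * c) (a ^+ 2) (- c ^+ 2) (1 + a * c)).
Proof.
case: dG => -[GSL _ GM GV] _ Gg; rewrite -(@conj_T1 a b c d).
  by apply: (GM _ _ (GM _ _ _ _) (GV _ _)).
by have := GSL _ Gg; rewrite /SL2 /= det_mx2E.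
Qed.

(* The iterates of [g |-> g T1 g^-1] have lower-left entries [- c ^ 2, - c ^ 4, ...]
   and tend to [T1]. *)
Lemma shimizu (a b c d : C) : G (mx2 a b c d) -> c != 0 -> 1 <= modc c.
Proof.
move=> Gg c0; rewrite leNgt; apply/negP => c1.
have [e e_gt0 eG] := (isolatedP GT1).1 (dG.2 _ GT1).
have k0 : 0 < modc c by rewrite modc_gt0.
(* [M] bounds the upper-left entries of all iterates: M (1 - k) >= 1, so |a'| <= M and |c'| <= k
   give |1 - a' c'| <= 1 + M k <= M. *)
pose k := modc c; pose M := modc a + (1 - k)^-1.
have kX n : k ^+ n.+1 <= k.
  rewrite exprS; apply: ler_piMr; first exact: ltW.
  by apply: exprn_ile1; exact: ltW.
have iter n : exists a' b' c' d',
    [/\ G (mx2 a' b' c' d'), c' != 0, modc c' <= k ^+ n.+1 & modc a' <= M].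
  elim: n => [|n [a' [b' [c' [d' [Gg' c'0 c'k a'M]]]]]].
    exists a, b, c, d; split => //; rewrite /M lerDl invr_ge0 subr_ge0 ltW //.
  exists (1 - a' * c'), (a' ^+ 2), (- c' ^+ 2), (1 + a' * c'); split.
  - exact: shimizu_step Gg'.
  - by rewrite oppr_eq0 expf_eq0.
  - rewrite modcN modcX.
    rewrite expr2 [leRHS]exprS ler_pM ?modc_ge0 //.
    exact: le_trans c'k (kX n).
  - have kn := le_trans c'k (kX n).
    apply: le_trans (modcD _ _) _; rewrite modc1 modcN modcM.
    have : modc a' * modc c' <= M * k by rewrite ler_pM ?modc_ge0.
    have : M * (1 - k) = modc a * (1 - k) + 1 by rewrite /M; field; rewrite subr_eq0 eq_sym lt_eqF.
    have : 0 <= modc a * (1 - k) by rewrite mulr_ge0 ?modc_ge0 // subr_ge0 ltW.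
    by move: (M) (modc a' * modc c') (modc a * (1 - k)) (k) => *; lra.
have M1 : 1 <= M.
  have : 1 <= (1 - k)^-1 by rewrite invf_ge1 ?subr_gt0 // gerBl ltW.
  by rewrite /M; have := modc_ge0 a; lra.
have [n kn] : exists n, k ^+ n.+1 * (3 * M) < Num.min e 1.
  have M0 : 0 < 3 * M by lra.
  have q0 : 0 < Num.min e 1 / (3 * M) by rewrite divr_gt0 // lt_min e_gt0 ltr01.
  have [n nP] : exists n, k ^+ n < Num.min e 1 / (3 * M).
    have k1 : `|k| < 1 by rewrite ger0_norm // modc_ge0.
    have /cvgr0Pnorm_lt /(_ _ q0) [n _ /(_ n (leqnn n))] := cvg_expr k1.
    by exists n; apply: le_lt_trans (ler_norm _) _.
  exists n; rewrite -ltr_pdivlMr //; apply: le_lt_trans nP.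
  by rewrite exprS; apply: ler_piMl; [rewrite exprn_ge0 ?modc_ge0 | exact: ltW].
have [a' [b' [c' [d' [Gg' c'0 c'k a'M]]]]] := iter n.
(* Two more steps are needed: the first brings the upper-left entry [a2] close to 1, and only the
   second makes the upper-right entry [a2 ^+ 2] close to 1. *)
have Gg3 := shimizu_step (shimizu_step Gg').
set a2 := 1 - a' * c' in Gg3; set c2 := - c' ^+ 2 in Gg3.
pose h := M * k ^+ n.+1.
have [he h1] : 3 * h < e /\ 3 * h < 1.
  by move: kn; rewrite lt_min => /andP[? ?]; split; rewrite /h; lra.
have c'h : modc c' <= h by apply: le_trans c'k _; rewrite /h ler_peMl // exprn_ge0 // ltW.
have xh : modc (a' * c') <= h by rewrite modcM ler_pM ?modc_ge0.
have h0 : 0 <= h by apply: le_trans c'h; exact: modc_ge0.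
have c2h : modc c2 <= h.
  rewrite modcN modcX; move: (modc_ge0 c') c'h; move: (modc c') => v; clear -h1 h0 => *; nra.
have a2h : modc a2 <= 2.
  apply: le_trans (modcD _ _) _; rewrite modcN modc1; lra.
have a2c2 : modc (a2 * c2) <= 2 * h by rewrite modcM ler_pM ?modc_ge0.
have : mx2 (1 - a2 * c2) (a2 ^+ 2) (- c2 ^+ 2) (1 + a2 * c2) = T1.
  apply: eG => // i j; rewrite !mxE.
  case: i => [[|[|//]] ?]; case: j => [[|[|//]] ?] /=.
  - have -> : 1 - (1 - a2 * c2) = a2 * c2 by ring.
    by apply: le_lt_trans a2c2 _; lra.
  - have -> : 1 - a2 ^+ 2 = (a' * c') * (2 - a' * c') by rewrite /a2; ring.
    rewrite modcM; have : modc (2 - a' * c') <= 3.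
      by apply: le_trans (modcD _ _) _; rewrite modcN modc_nat; lra.
    move: (modc_ge0 (a' * c')) (modc_ge0 (2 - a' * c')) xh.
    move: (modc _) (modc _) => u v; clear -he h1 h0 => *; nra.
  - have -> : 0 - - c2 ^+ 2 = c2 ^+ 2 by ring.
    rewrite modcX; move: (modc_ge0 c2) c2h.
    by move: (modc _) => v; clear -he h1 h0 => *; nra.
  - have -> : 1 - (1 + a2 * c2) = - (a2 * c2) by ring.
    by rewrite modcN; apply: le_lt_trans a2c2 _; lra.
(* The lower-left entry of [T1] vanishes, whereas that of the iterate is, up to sign, a power of the
   nonzero [c']. *)
move/matrixP => /(_ 1 0); rewrite !mxE /= => /eqP.
by rewrite oppr_eq0 expf_eq0 /= oppr_eq0 expf_eq0 /= (negPf c'0).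
Qed.
End Shimizu.

(** * Integrality from powers with a common denominator *)

Section BoundedPowers.
Variables (R : realType) (m : nat).
Hypothesis hm : squarefree m.
Local Notation O := (@ring_of_integers R m).

Lemma quad_field_of_multiple (Q : nat) (z : R[i]) :
  (0 < Q)%N -> O (Q%:R * z) -> quad_field m z.
Proof.
move=> Q0 [KQ _]; have QC : (Q%:R : R[i]) != 0 by rewrite pnatr_eq0 -lt0n.
rewrite -(mulKf QC z); apply: quad_fieldM KQ.
exact/quad_fieldV/quad_field_nat.
Qed.

(* The [z ^+ (2 ^ n)] fall into finitely many classes modulo [O], so two of them
   differ by an integer and [z] is a root of a monic [X^j - X^i - o]. *)
Lemma integers_bounded_powers (Q : nat) (z : R[i]) : (0 < Q)%N ->
  (forall n, O (Q%:R * z ^+ (2 ^ n))) -> O z.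
Proof.
case: Q => // q _ Oz; set Q := q.+1 in Oz.
have /choice[p pP] (n : nat) : exists p : int * int,
    Q%:R * z ^+ (2 ^ n) = p.1%:~R + p.2%:~R * int_gen R m.
  by have /(integersP hm)[a [b ?]] := Oz n; exists (a, b).
pose r (x : int) : 'I_q.+1 := inord (absz (x %% Q)%Z).
have rP (x y : int) : r x = r y -> exists k : int, x - y = Q%:Z * k.
  have rlt (u : int) : (absz (u %% Q)%Z < q.+1)%N.
    by have := modz_ge0 u (isT : Q%:Z != 0); have := @ltz_pmod u Q isT; lia.
  move/(congr1 val); rewrite /= !inordK // => e.
  exists ((x %/ Q)%Z - (y %/ Q)%Z).
  have ex := divz_eq x Q; have ey := divz_eq y Q.
  have x0 := modz_ge0 x (isT : Q%:Z != 0); have y0 := modz_ge0 y (isT : Q%:Z != 0).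
  have {}e : (x %% Q)%Z = (y %% Q)%Z by lia.
  by rewrite {1}ex {1}ey e; ring.
have [i [j [ij _ [/esym/rP[k1 e1] /esym/rP[k2 e2]]]]] :=
  pigeonhole_nat (fun n => (r (p n).1, r (p n).2)).
have QC : (Q%:R : R[i]) != 0 by rewrite pnatr_eq0.
apply: (@integers_pow_sub R m z (2 ^ i) (2 ^ j)); first by rewrite ltn_exp2l.
  by apply: (quad_field_of_multiple (Q := Q)) => //; exact: (Oz 0%N).
have -> : z ^+ (2 ^ j) - z ^+ (2 ^ i) = k1%:~R + k2%:~R * int_gen R m.
  apply: (mulfI QC); rewrite mulrBr !pP.
  transitivity (((p j).1 - (p i).1)%:~R + ((p j).2 - (p i).2)%:~R * int_gen R m).
    by rewrite !rmorphB /=; ring.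
  by rewrite e1 e2 !rmorphM /= -pmulrn; ring.
by apply/integersP => //; exists k1, k2.
Qed.

End BoundedPowers.

(** * Discrete extensions of [GammaK] and the unique maximal one *)

Section Extension.
Variables (R : realType) (m : nat).
Hypothesis hm : squarefree m.
Local Notation C := R[i].
Local Notation O := (@ring_of_integers R m).
Local Notation K := (@quad_field R m).

Lemma GammaK_mx2 (a b c d : C) : O a -> O b -> O c -> O d ->
  a * d - b * c = 1 -> GammaK m (mx2 a b c d).
Proof.
move=> Oa Ob Oc Od det1; split; first exact: SL2_mx2.
by move=> i j; rewrite mxE; case: ifP; case: ifP.
Qed.

Local Notation T1 := (mx2 1 1 0 1 : 'M[C]_2).
Local Notation U1 := (mx2 1 0 1 1 : 'M[C]_2).
Local Notation S := (mx2 0 (-1) 1 0 : 'M[C]_2).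

Section DiscreteExtension.
Variable G : set 'M[C]_2.
Hypotheses (dG : discrete_subgroup G) (GG : GammaK m `<=` G).

Let O0 : O 0 := integers0 R m.
Let O1 : O 1 := integers1 R m.
Let ON1 : O (-1) := integersN O1.

Let GM A B : G A -> G B -> G (A *m B).
Proof. by case: dG => -[_ _ + _] _; apply. Qed.

Let G_T1 : G T1. Proof. by apply/GG/GammaK_mx2 => //; ring. Qed.
Let G_U1 : G U1. Proof. by apply/GG/GammaK_mx2 => //; ring. Qed.
Let G_S : G S. Proof. by apply/GG/GammaK_mx2 => //; ring. Qed.

Let Gdet (a b c d : C) : G (mx2 a b c d) -> a * d - b * c = 1.
Proof. by case: dG => -[+ _ _ _] _ => /[apply]; rewrite /SL2 /= det_mx2E. Qed.

(** Multiplying by [S] on either side moves any entry, up to sign, to the lower-left corner, where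
    Shimizu's lemma applies. *)
Lemma ext_swap_rows (a b c d : C) :
  G (mx2 a b c d) -> G (mx2 (- c) (- d) a b).
Proof.
move/(GM G_S); rewrite mx2_mul; congr (G (mx2 _ _ _ _)); ring.
Qed.

Lemma ext_swap_cols (a b c d : C) :
  G (mx2 a b c d) -> G (mx2 b (- a) d (- c)).
Proof.
move=> Gg; have := GM Gg G_S; rewrite mx2_mul; congr (G (mx2 _ _ _ _)); ring.
Qed.

Lemma ext_add_rows (a b c d : C) :
  G (mx2 a b c d) -> G (mx2 a b (a + c) (b + d)).
Proof.
move/(GM G_U1); rewrite mx2_mul; congr (G (mx2 _ _ _ _)); ring.
Qed.

(* [x c + y d] is, up to sign, the square root of the lower-left entry of a
   conjugate by [g] of a parabolic element of [GammaK]. *)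
Lemma ext_row2_separated (a b c d : C) :
  G (mx2 a b c d) -> unit_separated (row_module m c d).
Proof.
move=> Gg z [x [y [Ox Oy ez]]] z0.
have det1 := Gdet Gg.
have GP : G (mx2 (1 - x * y) (x ^+ 2) (- y ^+ 2) (1 + x * y)).
  apply/GG/GammaK_mx2; last by ring.
  - by apply: integersD => //; exact/integersN/integersM.
  - exact: integersX.
  - exact/integersN/integersX.
  - by apply: integersD => //; exact: integersM.
have GI : G (mx2 d (- b) (- c) a).
  by rewrite -invmx_mx2 //; case: dG => -[_ _ _ +] _; apply.
have := GM (GM Gg GP) GI; rewrite !mx2_mul.
set l := (X in mx2 _ _ X _); have -> : l = - z ^+ 2 by rewrite /l ez; ring.
move/(shimizu dG G_T1).
rewrite modcN modcX oppr_eq0 expf_eq0 z0 => /(_ isT).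
by move=> ?; rewrite -(ler_sqr (_ : 1 \is Num.nneg)) ?nnegrE ?modc_ge0 // expr1n.
Qed.

Lemma ext_row1_separated (a b c d : C) :
  G (mx2 a b c d) -> unit_separated (row_module m a b).
Proof. by move/ext_swap_rows/ext_row2_separated. Qed.

End DiscreteExtension.

(** Entries [x], [y] from different rows are handled by [rows_bounded_denominator]. Within one row,
    x y = x (y + y') - x y' with [y'] below [y]; adding the rows stays in [G], so both terms are
    products across rows. *)
Lemma ext_bounded_denominator : exists2 Q : nat, (0 < Q)%N &
  forall G : set 'M[C]_2, discrete_subgroup G -> GammaK m `<=` G ->
  forall a b c d, G (mx2 a b c d) ->
  {in [:: a; b; c; d] &, forall x y, O (Q%:R * (x * y))}.
Proof.
have [Q Q0 QP] := rows_bounded_denominator R hm; exists Q => // G dG GG.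
have cross a b c d : G (mx2 a b c d) ->
    {in [:: a; b], forall x, {in [:: c; d], forall y, O (Q%:R * (x * y))}}.
  move=> Gg x xP y yP; apply: (QP a b c d).
  - by have [[/(_ _ Gg)]] := dG; rewrite /SL2 /= det_mx2E.
  - exact: ext_row1_separated Gg.
  - exact: ext_row2_separated Gg.
  - by move: xP; rewrite !inE => /orP[] /eqP ->; [exact: row_module_l | exact: row_module_r].
  - by move: yP; rewrite !inE => /orP[] /eqP ->; [exact: row_module_l | exact: row_module_r].
have same a b c d : G (mx2 a b c d) ->
    {in [:: a; b] &, forall x y, O (Q%:R * (x * y))}.
  move=> Gg x y xP yP.
  have [y' y'P yy'] : exists2 y', y' \in [:: c; d] & y + y' \in [:: a + c; b + d].
    move: yP; rewrite !inE => /orP[] /eqP ->; [exists c | exists d];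
    by rewrite !inE eqxx ?orbT.
  have -> : Q%:R * (x * y) = Q%:R * (x * (y + y')) - Q%:R * (x * y') by ring.
  apply: integersD; first exact: cross (ext_add_rows dG GG Gg) _ xP _ yy'.
  exact/integersN/(cross _ _ _ _ Gg _ xP _ y'P).
move=> a b c d Gg.
have Gg' := ext_swap_rows dG GG Gg.
have row2 x y : x \in [:: c; d] -> y \in [:: c; d] -> O (Q%:R * (x * y)).
  move=> xP yP; rewrite -(mulrNN x y); apply: same Gg' _ _ _ _;
  by move: xP yP; rewrite !inE !eqr_opp.
have mem4 z : z \in [:: a; b; c; d] = (z \in [:: a; b]) || (z \in [:: c; d]).
  by rewrite -mem_cat.
move=> x y; rewrite !mem4 => /orP[xP|xP] /orP[yP|yP].
- exact: same Gg _ _ xP yP.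
- exact: cross Gg _ xP _ yP.
- by rewrite (mulrC x); exact: cross Gg _ yP _ xP.
- exact: row2.
Qed.

(** Iterating [shimizu_step] gives, up to sign, lower-left entries c^(2^n), so all powers
    (c^2)^(2^n) share the denominator [Q] and c^2 is integral. The swaps extend this to every entry,
    and the common denominator puts the products in [K]. *)
Lemma ext_products (G : set 'M[C]_2) :
  discrete_subgroup G -> GammaK m `<=` G ->
  forall a b c d, G (mx2 a b c d) ->
  {in [:: a; b; c; d] &, forall x y, O (x * y)}.
Proof.
move=> dG GG; have [Q Q0 /(_ G dG GG) QP] := ext_bounded_denominator.
have T1G : G T1.
  apply/GG/GammaK_mx2;
    [exact: integers1 | exact: integers1 | exact: integers0 | exact: integers1 | ring].
have lower_left a b c d : G (mx2 a b c d) -> O (c ^+ 2).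
  move=> Gg; apply: (integers_bounded_powers hm Q0) => n.
  have [a' [b' [c' [d' [Gg' <-]]]]] : exists a' b' c' d',
      G (mx2 a' b' c' d') /\ c' ^+ 2 = (c ^+ 2) ^+ (2 ^ n).
    elim: n => [|n [a' [b' [c' [d' [Gg' ec]]]]]]; first by exists a, b, c, d.
    do 4!eexists; split; first exact: (shimizu_step dG T1G Gg').
    by rewrite ec sqrrN expnS mulnC exprM.
  by rewrite expr2; apply: QP Gg' _ _ _ _; rewrite !inE eqxx ?orbT.
move=> a b c d Gg.
have sq : {in [:: a; b; c; d], forall x, O (x ^+ 2)}.
  move=> x; rewrite !inE => /or4P[] /eqP ->.
  - exact: lower_left (ext_swap_rows dG GG Gg).
  - exact: lower_left (ext_swap_rows dG GG (ext_swap_cols dG GG Gg)).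
  - exact: lower_left Gg.
  - exact: lower_left (ext_swap_cols dG GG Gg).
move=> x y xP yP; apply: integers_mul_sqr; [exact: sq | exact: sq |].
by apply: quad_field_of_multiple Q0 _; exact: QP Gg _ _ xP yP.
Qed.

Definition max_ext : set 'M[C]_2 :=
  [set A | SL2 A /\ forall i j k l, O (A i j * A k l)].

Lemma max_ext_mx2 (a b c d : C) : max_ext (mx2 a b c d) <->
  a * d - b * c = 1 /\ {in [:: a; b; c; d] &, forall x y, O (x * y)}.
Proof.
split=> [[] | [det1 H]].
  rewrite /SL2 /= det_mx2E => det1 H; split=> //.
  have ent x : x \in [:: a; b; c; d] -> exists i j, x = mx2 a b c d i j.
    rewrite !inE => /or4P[] /eqP ->.
    - by exists 0, 0; rewrite mxE.
    - by exists 0, 1; rewrite mxE.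
    - by exists 1, 0; rewrite mxE.
    - by exists 1, 1; rewrite mxE.
  by move=> x y /ent[i [j ->]] /ent[k [l ->]].
split; first exact: SL2_mx2.
have ent i j : mx2 a b c d i j \in [:: a; b; c; d].
  by rewrite mxE !inE; case: ifP; case: ifP; rewrite eqxx ?orbT.
by move=> i j k l; exact: H.
Qed.

Lemma discrete_ext_sub (G : set 'M[C]_2) :
  discrete_subgroup G -> GammaK m `<=` G -> G `<=` max_ext.
Proof.
move=> dG GG A; have [a [b [c [d ->]]]] := mx2P A => Gg.
apply/max_ext_mx2; split; last exact: ext_products Gg.
by have [[/(_ _ Gg)]] := dG; rewrite /SL2 /= det_mx2E.
Qed.

Lemma GammaK_max_ext : GammaK m `<=` max_ext.
Proof. by move=> A [SA OA]; split=> // i j k l; exact: integersM. Qed.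

(** A product of two entries of [A *m B] is a sum of terms that regroup into a product of entries of
    [A] times a product of entries of [B]. The inverse has the same entries up to sign and
    position. *)
Lemma max_ext_subgroup : SL2_subgroup max_ext.
Proof.
split=> [A [] // | | A B [SA OA] [SB OB] | A].
- by apply: GammaK_max_ext; rewrite -mx2_1; apply: GammaK_mx2;
     [exact: integers1 | exact: integers0 | exact: integers0 | exact: integers1 | ring].
- split; first by move: SA SB; rewrite /SL2 /= det_mulmx => -> ->; rewrite mulr1.
  move=> i j k l; rewrite !mxE !big_ord_recl !big_ord0 !addr0.
  have H i' j' k' l' i'' j'' k'' l'' :
      O (A i' j' * B i'' j'' * (A k' l' * B k'' l'')).
    by rewrite mulrACA; exact: integersM.
  rewrite mulrDl !mulrDr; do !apply: integersD; exact: H.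
- have [a [b [c [d ->]]]] := mx2P A => /max_ext_mx2[det1 H].
  rewrite invmx_mx2 //; apply/max_ext_mx2; split; first by rewrite -det1; ring.
  have sgn x : x \in [:: d; - b; - c; a] ->
      exists2 y, y \in [:: a; b; c; d] & x = y \/ x = - y.
    rewrite !inE => /or4P[] /eqP ->; [exists d | exists b | exists c | exists a];
    by rewrite ?inE ?eqxx ?orbT //; auto.
  move=> x y /sgn[x' x'P ex] /sgn[y' y'P ey].
  have Oxy : O (x' * y') by exact: H.
  by case: ex ey => -> [] ->; rewrite ?(mulrNN, mulrN, mulNr) //; exact: integersN.
Qed.

(* Entries of [max_ext] are determined up to a common sign by their pairwise
   products, and these lie in the discrete set [O]. *)
Lemma max_ext_discrete : discrete_subgroup max_ext.
Proof.
split; first exact: max_ext_subgroup.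
move=> A gA; apply/(isolatedP gA); have [SA OA] := gA.
have [i0 [j0 nz]] := SL2_entry_neq0 SA.
pose M := \sum_i \sum_j modc (A i j).
have AM i j : modc (A i j) <= M.
  rewrite /M (bigD1 i) //= (bigD1 j) //= -addrA lerDl.
  by rewrite addr_ge0 ?sumr_ge0 // => *; rewrite ?sumr_ge0 // => *; exact: modc_ge0.
have M0 : 0 <= M := le_trans (modc_ge0 _) (AM 0 0).
have M20 : 0 < 2 * M + 2 by lra.
(* The first bound excludes [B i0 j0 = - A i0 j0]; the second keeps corresponding products of
   entries of [A] and [B] at distance below 1. *)
exists (Num.min (modc (A i0 j0)) (2 * M + 2)^-1).
  by rewrite lt_min modc_gt0 nz invr_gt0.
move=> B [SB OB] AB.
have AB1 i j : modc (A i j - B i j) < modc (A i0 j0).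
  by have := AB i j; rewrite lt_min => /andP[].
have AB2 i j : modc (A i j - B i j) * (2 * M + 2) < 1.
  by have := AB i j; rewrite lt_min => /andP[_]; rewrite -ltr_pdivlMr // mul1r.
have prod i j k l : A i j * A k l = B i j * B k l.
  apply/eqP; rewrite -subr_eq0; apply/negPn/negP => neq.
  have := integers_modc_ge1 hm (integersD (OA i j k l) (integersN (OB i j k l))) neq.
  apply/negP; rewrite -ltNge.
  have -> : A i j * A k l - B i j * B k l =
    A i j * (A k l - B k l) + (A k l - (A k l - B k l)) * (A i j - B i j) by ring.
  apply: le_lt_trans (modcD _ _) _; rewrite !modcM.
  have h1 : modc (A k l - (A k l - B k l)) <= modc (A k l) + modc (A k l - B k l).
    by apply: le_trans (modcD _ _) _; rewrite modcN.
  have := AM i j; have := AM k l; have := AB2 i j; have := AB2 k l.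
  move: h1 (modc_ge0 (A i j)) (modc_ge0 (A k l - B k l)) (modc_ge0 (A i j - B i j)).
  move: (modc (A i j)) (modc (A k l)) (modc (A k l - B k l)) (modc (A i j - B i j)) => a b u v.
  move: (modc _) => w h1 a0 u0 v0 h2 h3 bM aM.
  have : a * u <= M * u by rewrite ler_wpM2r.
  have : w * v <= (M + u) * v by rewrite ler_wpM2r //; lra.
  have : u < 2^-1 by clear -h2 M0 u0; nra.
  clear -h2 h3 M0 u0 v0 => *; nra.
have e0 : B i0 j0 = A i0 j0.
  have /eqP := prod i0 j0 i0 j0; rewrite -!expr2 eqf_sqr => /orP[/eqP -> //|/eqP e].
  have := AB1 i0 j0; rewrite {1}e.
  have -> : - B i0 j0 - B i0 j0 = - (2 * B i0 j0) by ring.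
  rewrite modcN modcM modc_nat e modcN => lt; exfalso.
  by move: lt (modc_ge0 (B i0 j0)); clear => *; lra.
by apply/matrixP => i j; have := prod i0 j0 i j; rewrite e0 => /(mulfI nz).
Qed.

Lemma max_ext_maximal : maximal_discrete_extension (GammaK m) max_ext.
Proof.
split; [exact: max_ext_discrete | exact: GammaK_max_ext |].
move=> G dG sub; apply/seteqP; split=> //.
by apply: discrete_ext_sub => // A /GammaK_max_ext /sub.
Qed.

Lemma maximal_extension_unique (G : set 'M[C]_2) :
  maximal_discrete_extension (GammaK m) G -> G = max_ext.
Proof.
move=> [dG GG maxG]; apply/esym/maxG; first exact: max_ext_discrete.
exact: discrete_ext_sub.
Qed.

End Extension.

(** * Squarefree natural numbers *)

Section SquarefreeNat.

Lemma squarefree_dvdn (d n : nat) : squarefree d ->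
  (forall p, prime p -> (p %| d)%N -> (p %| n)%N) -> (d %| n)%N.
Proof.
move=> sqd H; have d0 := squarefree_gt0 sqd; apply/dvdn_partP => // p.
rewrite mem_primes => /and3P[pp _ pd]; rewrite p_part.
suff -> : logn p d = 1%N by rewrite expn1 H.
apply/eqP; rewrite eqn_leq logn_gt0 mem_primes pp d0 pd !andbT leqNgt.
apply/negP; rewrite -pfactor_dvdn // => /sqd p1.
by rewrite p1 in pp.
Qed.

Lemma squarefree_part (n : nat) : (0 < n)%N ->
  exists d t, [/\ squarefree d, (0 < t)%N & n = (d * t ^ 2)%N].
Proof.
elim/ltn_ind: n => n IH n0.
have [sqn|] := pselect (squarefree n); first by exists n, 1%N; rewrite muln1.
move=> /existsNP[k] /not_implyP[/dvdnP[q eq] k1].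
have k0 : (0 < k)%N by case: k eq {k1} => // eq; move: n0; rewrite eq muln0.
have q0 : (0 < q)%N by move: n0; rewrite eq muln_gt0 => /andP[].
have [|//|d [t [sqd t0 et]]] := IH q.
  by rewrite eq -{1}[q]muln1 ltn_mul2l q0 (ltn_exp2l 0) //; lia.
by exists d, (t * k)%N; rewrite muln_gt0 t0 k0 eq et expnMn mulnA.
Qed.

End SquarefreeNat.

(** * Squarefree divisors of the discriminant *)

Section Divisors.
Variable m : nat.
Hypothesis hm : squarefree m.

(** An odd prime factor of the discriminant divides m, and so does 2 when m is 2 mod 4.
    Squarefreeness excludes 0 mod 4, leaving 2 with m = 1 mod 4 as the only exception. *)
Lemma sqf_divisors_prime (d p : nat) : sqf_divisors (discK m) d ->
  prime p -> (p %| d)%N -> (p %| m)%N \/ p = 2 /\ (m %% 4 = 1)%N.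
Proof.
move=> [dD sqd] pp pd; have := dvdn_trans pd (_ : d %| `|discK m|)%N.
rewrite /discK; move: dD; rewrite dvdzE /= => dD /(_ dD).
have m4 : (m %% 4 != 0)%N.
  by apply/negP => /eqP m40; have := hm (k := 2); rewrite /dvdn m40 => /(_ erefl).
case: ifP => m3; rewrite abszN absz_nat; first by left.
rewrite Euclid_dvdM // => /orP[]; last by left.
rewrite (_ : 4 = 2 ^ 2)%N // Euclid_dvdX // andbT dvdn_prime2 // => /eqP p2.
have [m1|m1] := eqVneq (m %% 4)%N 1%N; first by right.
by left; rewrite p2; lia.
Qed.

(** The first divisibility makes the quotient in [bezout] exact. The other two concern the
    coordinates of omega^2 = m (m - 1) + 2 m sqrt(-m), so that omega^2 / d is an integer of [K]. *)
Lemma sqf_divisors_dvdn (d : nat) : sqf_divisors (discK m) d ->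
  [/\ (d %| m ^ 2 + m)%N, (d %| m * m.-1)%N & (d %| 2 * m)%N].
Proof.
move=> dD; have sqd := dD.2.
split; apply: squarefree_dvdn => // p pp /(sqf_divisors_prime dD pp).
- by case=> [pm|[-> m1]]; [rewrite dvdn_add ?dvdn_exp | lia].
- by case=> [pm|[-> m1]]; [rewrite dvdn_mulr | rewrite dvdn_mull //; lia].
- by case=> [pm|[-> m1]]; [rewrite dvdn_mull | rewrite dvdn_mulr].
Qed.

(** A common prime p would give p^2 | m (m + 1). If p | m, then p^2 | m, against squarefreeness; if
    p = 2 and m = 1 mod 4, then m (m + 1) is 2 mod 4. *)
Lemma sqf_divisors_coprime (d : nat) : sqf_divisors (discK m) d ->
  coprime d ((m ^ 2 + m) %/ d).
Proof.
move=> dD; have d0 := squarefree_gt0 dD.2; have [dN _ _] := sqf_divisors_dvdn dD.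
apply/negPn/negP => ncop.
have g1 : (1 < gcdn d ((m ^ 2 + m) %/ d))%N.
  by rewrite ltn_neqAle eq_sym ncop gcdn_gt0 d0.
have pp := pdiv_prime g1; set p := pdiv _ in pp.
have := pdiv_dvd (gcdn d ((m ^ 2 + m) %/ d)); rewrite -/p dvdn_gcd => /andP[pd pN].
have p2N : (p ^ 2 %| m * m.+1)%N.
  rewrite mulnS -mulnn addnC -(divnK dN) mulnC -mulnn dvdn_mul //.
have [pm|[p2 m1]] := sqf_divisors_prime dD pp pd.
  have : (p ^ 2 %| m)%N.
    rewrite -(@Gauss_dvdl _ _ m.+1) // coprimeXl // prime_coprime //.
    by rewrite -addn1 dvdn_addr // dvdn1; apply/negP => /eqP p1; rewrite p1 in pp.
  by move/hm => p1; rewrite p1 in pp.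
move: p2N; rewrite p2 => /dvdnP[q]; have -> : m = (4 * (m %/ 4) + 1)%N by lia.
by lia.
Qed.

Lemma bezout_exists (d : nat) : sqf_divisors (discK m) d ->
  exists u v : int, bezout m d u v.
Proof.
move=> /sqf_divisors_coprime cop.
have [u [v e]] := Bezoutz d%:Z ((m ^ 2 + m) %/ d)%N%:Z.
exists u, (- v); rewrite /bezout mulNr opprK e.
by rewrite /gcdz !absz_nat (eqP cop).
Qed.

End Divisors.

(** * Cosets of [GammaK] labelled by squarefree numbers *)

Section Cosets.
Variables (R : realType) (m : nat).
Hypothesis hm : squarefree m.
Local Notation C := R[i].
Local Notation O := (@ring_of_integers R m).
Local Notation K := (@quad_field R m).
Local Notation "d '%:sqrt'" := ((Num.sqrt (d%:R : R))%:C%C) (at level 2).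

Lemma natsqrt_sq (d : nat) : d%:sqrt ^+ 2 = d%:R.
Proof. by rewrite -rmorphXn /= sqr_sqrtr ?ler0n // rmorph_nat. Qed.

Lemma natsqrt_neq0 (d : nat) : (0 < d)%N -> d%:sqrt != 0.
Proof.
by move=> d0; rewrite -sqrf_eq0 natsqrt_sq pnatr_eq0 -lt0n.
Qed.

(** The matrix is defined over [K] up to the factor sqrt d; this [d] is the label of its coset. *)
Definition scaled_quad (d : nat) (A : 'M[C]_2) := forall i j, K (d%:sqrt * A i j).

Lemma GammaK_mul (A B : 'M[C]_2) : GammaK m A -> GammaK m B -> GammaK m (A *m B).
Proof.
move=> [SA OA] [SB OB]; split.
  by move: SA SB; rewrite /SL2 /= det_mulmx => -> ->; rewrite mulr1.
move=> i j; rewrite mxE !big_ord_recl big_ord0 addr0.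
by apply: integersD; exact: integersM.
Qed.

(** For entries x of [A] and y of [B], the factors sqrt d combine to put x y in [K], and x^2 y^2 is
    integral, so x y is integral. The entries of [invmx B] are those of [B] up to sign. *)
Lemma scaled_quotient (d : nat) (A B : 'M[C]_2) : (0 < d)%N ->
  max_ext m A -> max_ext m B -> scaled_quad d A -> scaled_quad d B ->
  GammaK m (A *m invmx B).
Proof.
move=> d0 [SA OA] gB KA KB; have [SB OB] := gB.
have AB i j k l : O (A i j * B k l).
  apply: integers_mul_sqr; rewrite ?expr2 //.
  have -> : A i j * B k l = (d%:R)^-1 * ((d%:sqrt * A i j) * (d%:sqrt * B k l)).
    by rewrite -natsqrt_sq; field; exact: natsqrt_neq0.
  apply: quad_fieldM; last exact: quad_fieldM.
  exact/quad_fieldV/quad_field_nat.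
split.
  move: SA SB; rewrite /SL2 /= det_mulmx det_inv => -> ->.
  by rewrite invr1 mulr1.
have ent i j : exists k l, invmx B i j = B k l \/ invmx B i j = - B k l.
  move: SB; have [a [b [c [e ->]]]] := mx2P B; rewrite /SL2 /= det_mx2E => /invmx_mx2 ->.
  rewrite mxE; case: ifP => _; case: ifP => _.
  - by exists 1, 1; rewrite mxE; left.
  - by exists 0, 1; rewrite mxE; right.
  - by exists 1, 0; rewrite mxE; right.
  - by exists 0, 0; rewrite mxE; left.
have ABi i j k l : O (A i j * invmx B k l).
  by have [k' [l' [->|->]]] := ent k l; rewrite ?mulrN //; exact: integersN.
by move=> i j; rewrite mxE !big_ord_recl big_ord0 addr0; apply: integersD.
Qed.

Lemma scaled_rcoset (d : nat) (A B : 'M[C]_2) : (0 < d)%N ->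
  max_ext m A -> max_ext m B -> scaled_quad d A -> scaled_quad d B ->
  rcoset (GammaK m) A B.
Proof.
move=> d0 gA gB KA KB; exists (B *m invmx A); first exact: scaled_quotient KA.
by rewrite mulmxKV // unitmxE gA.1 unitr1.
Qed.

Lemma scaled_rcoset_eq (d : nat) (A B : 'M[C]_2) : (0 < d)%N ->
  max_ext m A -> max_ext m B -> scaled_quad d A -> scaled_quad d B ->
  rcoset (GammaK m) A = rcoset (GammaK m) B.
Proof.
move=> d0 gA gB KA KB; apply/seteqP; split => _ [X gX <-].
  have [Y gY <-] := scaled_rcoset d0 gB gA KB KA.
  by exists (X *m Y); [exact: GammaK_mul | rewrite mulmxA].
have [Y gY <-] := scaled_rcoset d0 gA gB KA KB.
by exists (X *m Y); [exact: GammaK_mul | rewrite mulmxA].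
Qed.

Section Representatives.
Variables (d : nat) (u v : int).
Hypotheses (dD : sqf_divisors (discK m) d) (uv : bezout m d u v).

Let d0 : (0 < d)%N := squarefree_gt0 dD.2.
Let r0 : d%:sqrt != 0 := natsqrt_neq0 d0.
Let dC : (d%:R : C) != 0. Proof. by rewrite pnatr_eq0 -lt0n. Qed.

Lemma VdE : Vd R m d u v =
  mx2 (u%:~R * d%:R / d%:sqrt) (v%:~R * omega R m / d%:sqrt)
      (conjc (omega R m) / d%:sqrt) (d%:R / d%:sqrt).
Proof.
apply/matrixP => i j; rewrite !mxE mulrC.
by case: ifP => _; case: ifP => _.
Qed.

Lemma Vd_SL2 : SL2 (Vd R m d u v).
Proof.
have [dN _ _] := sqf_divisors_dvdn hm dD.
rewrite VdE; apply: SL2_mx2.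
transitivity ((u%:~R * d%:R ^+ 2 - v%:~R * (omega R m * conjc (omega R m))) / d%:sqrt ^+ 2).
  by field.
rewrite natsqrt_sq omega_norm -{1}(divnK dN) natrM.
transitivity ((u * d%:Z - v * ((m ^ 2 + m) %/ d)%N%:Z)%:~R : C).
  by rewrite rmorphB !rmorphM /= -!pmulrn; field.
by rewrite uv.
Qed.

Lemma Vd_scaled : scaled_quad d (Vd R m d u v).
Proof.
have Kw : K (omega R m).
  by apply: quad_fieldD; [exact: quad_field_nat | exact: quad_field_sqrtN].
move=> i j; rewrite VdE mxE mulrC; case: ifP => _; case: ifP => _; rewrite divfK //.
- by apply: quad_fieldM; [exact: quad_field_int | exact: quad_field_nat].
- by apply: quad_fieldM; [exact: quad_field_int |].
- exact: quad_field_conj.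
- exact: quad_field_nat.
Qed.

(** It suffices that squares of entries are integral, since sqrt d times the matrix is over [K]. The
    one substantial case is omega^2 / d. *)
Lemma Vd_max_ext : max_ext m (Vd R m d u v).
Proof.
split; first exact: Vd_SL2.
have sq i j : O (Vd R m d u v i j ^+ 2).
  have Ow : O (omega R m ^+ 2 / d%:R).
    have [_ /dvdnP[k1 e1] /dvdnP[k2 e2]] := sqf_divisors_dvdn hm dD.
    have -> : omega R m ^+ 2 / d%:R = k1%:R + k2%:R * sqrtN R m.
      have -> : omega R m ^+ 2 = (m * m.-1)%N%:R + (2 * m)%N%:R * sqrtN R m.
        have em : m.-1%:R = m%:R - 1 :> C.
          by rewrite -subn1 natrB // squarefree_gt0.
        rewrite !natrM em /omega.
        transitivity (m%:R ^+ 2 + sqrtN R m ^+ 2 + 2 * m%:R * sqrtN R m : C); first by ring.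
        by rewrite sqrtN2; ring.
      by rewrite e1 e2 !natrM; field.
    apply: integersD; first exact: integers_nat.
    by apply: integersM; [exact: integers_nat | exact: integers_sqrtN].
  rewrite VdE mxE.
  have sqE x : (x / d%:sqrt) ^+ 2 = x ^+ 2 / d%:R by rewrite expr_div_n natsqrt_sq.
  case: ifP => _; case: ifP => _; rewrite sqE.
  - have -> : (u%:~R * d%:R) ^+ 2 / d%:R = u%:~R ^+ 2 * d%:R :> C by field.
    by apply: integersM; [exact/integersX/integers_int | exact: integers_nat].
  - rewrite exprMn -mulrA; apply: integersM => //; exact/integersX/integers_int.
  - have -> : conjc (omega R m) ^+ 2 / d%:R = conjc (omega R m ^+ 2 / d%:R).
      by rewrite !expr2 !conjcM conjc_inv conjc_nat.
    exact: integers_conj.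
  - by rewrite expr2 mulfK //; exact: integers_nat.
move=> i j k l; apply: integers_mul_sqr => //.
have -> : Vd R m d u v i j * Vd R m d u v k l =
    d%:R^-1 * ((d%:sqrt * Vd R m d u v i j) * (d%:sqrt * Vd R m d u v k l)).
  by rewrite -natsqrt_sq; field.
apply: quad_fieldM; last by apply: quad_fieldM; exact: Vd_scaled.
exact/quad_fieldV/quad_field_nat.
Qed.

End Representatives.
End Cosets.

(** * Every element of [max_ext] lies in one of the cosets *)

Section Decomposition.
Variables (R : realType) (m : nat).
Hypothesis hm : squarefree m.
Local Notation C := R[i].
Local Notation O := (@ring_of_integers R m).
Local Notation K := (@quad_field R m).
Local Notation "d '%:sqrt'" := ((Num.sqrt (d%:R : R))%:C%C) (at level 2).

(** For unramified l the ring O / l O has no nilpotents. In coordinates z = p + q w, l divides both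
    p^2 - n q^2 and q (2 p + t q), and disc q^2 = 4 (p^2 - n q^2) - (2 p + t q)(2 p - t q) forces l
    | q, then l | p. *)
Lemma unramified_dvd (l : nat) (z o : C) : prime l -> ~ (l%:Z %| discK m)%Z ->
  O z -> O o -> z ^+ 2 = l%:R * o -> exists2 o', O o' & z = l%:R * o'.
Proof.
move=> pl lD /(integersP hm)[p [q ez]] /(integersP hm)[a [b eo]] ezo.
pose t := gen_trace m; pose n := gen_norm m.
have [e1 e2] : p ^+ 2 - n * q ^+ 2 = l%:Z * a /\ 2 * (p * q) + t * q ^+ 2 = l%:Z * b.
  apply: (int_gen_free (R := R) hm).
  transitivity (z ^+ 2); last by rewrite ezo eo !rmorphM /= -pmulrn; ring.
  rewrite ez !rmorphD !rmorphN !rmorphM /=.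
  transitivity (p%:~R ^+ 2 + 2 * (p%:~R * q%:~R) * int_gen R m +
     q%:~R ^+ 2 * int_gen R m ^+ 2); last by ring.
  by rewrite int_gen_sq /t /n; ring.
have lM (x y : int) : (l%:Z %| x * y)%Z -> (l%:Z %| x)%Z \/ (l%:Z %| y)%Z.
  by rewrite !dvdzE abszM !absz_nat Euclid_dvdM // => /orP.
have lq : (l%:Z %| q)%Z.
  have [//|l2] : (l%:Z %| q)%Z \/ (l%:Z %| 2 * p + t * q)%Z.
    by apply: lM; apply/dvdzP; exists b; rewrite [RHS]mulrC -e2; ring.
  suff : (l%:Z %| discK m * (q * q))%Z by case/lM => // /lM[].
  have -> : discK m * (q * q) =
      4 * (l%:Z * a) - (2 * p + t * q) * (2 * p - t * q).
    by rewrite -e1 disc_gen -/t -/n; ring.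
  by apply: rpredB; [rewrite mulrCA dvdz_mulr | exact: dvdz_mulr].
have lp : (l%:Z %| p)%Z.
  suff : (l%:Z %| p * p)%Z by case/lM.
  have -> : p * p = l%:Z * a + n * (q * q) by rewrite -e1; ring.
  by apply: rpredD; [rewrite dvdz_mulr | rewrite !dvdz_mull].
move/dvdzP: lp => [p' ep]; move/dvdzP: lq => [q' eq].
exists (p'%:~R + q'%:~R * int_gen R m); first by apply/integersP => //; exists p', q'.
by rewrite ez ep eq !rmorphM /= -pmulrn; ring.
Qed.

(* Were [l] a prime factor of [d] not dividing the discriminant, all entries of
   [sqrt d A] would be divisible by [l], hence [l ^ 2] would divide
   [\det (sqrt d A) = d]. *)
Lemma scaled_quad_disc (d : nat) (A : 'M[C]_2) : squarefree d ->
  max_ext m A -> scaled_quad m d A -> sqf_divisors (discK m) d.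
Proof.
move=> sqd [SA OA] KA; split=> //; have d0 := squarefree_gt0 sqd.
rewrite dvdzE absz_nat; apply: squarefree_dvdn => // l pl ld.
apply/negPn/negP => lD.
have {}lD : ~ (l%:Z %| discK m)%Z by rewrite dvdzE absz_nat; exact/negP.
have /dvdnP[d' ed] := ld.
have sqE i j : (d%:sqrt * A i j) ^+ 2 = d%:R * (A i j * A i j).
  by rewrite exprMn natsqrt_sq expr2.
have Osc i j : O (d%:sqrt * A i j).
  by apply: integers_sqr => //; rewrite sqE; apply: integersM => //; exact: integers_nat.
have div i j : exists2 o, O o & d%:sqrt * A i j = l%:R * o.
  apply: (unramified_dvd pl lD (Osc i j) (o := d'%:R * (A i j * A i j))).
    by apply: integersM => //; exact: integers_nat.
  by rewrite sqE ed natrM; ring.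
have [o Oo eo] : exists2 o, O o & (d%:R : C) = l%:R ^+ 2 * o.
  have [a [b [c [e eA]]]] := mx2P A.
  have [oa Oa ea] := div 0 0; have [ob Ob eb] := div 0 1.
  have [oc Oc ec] := div 1 0; have [oe Oe ee] := div 1 1.
  move: ea eb ec ee SA; rewrite eA !mxE /SL2 /= det_mx2E => ea eb ec ee det1.
  exists (oa * oe - ob * oc); first by apply: integersD (integersN _); exact: integersM.
  transitivity (d%:sqrt ^+ 2 * (a * e - b * c)); first by rewrite det1 mulr1 natsqrt_sq.
  transitivity ((d%:sqrt * a) * (d%:sqrt * e) - (d%:sqrt * b) * (d%:sqrt * c)); first by ring.
  by rewrite ea eb ec ee; ring.
have [k ek] := integers_modc hm Oo.
have : (d ^ 2 = (l ^ 2) ^ 2 * k)%N.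
  have := congr1 (@modc R) eo; rewrite modcM modcX !modc_nat => em.
  by apply/eqP; rewrite -(eqr_nat R) natrM !natrX -ek em exprMn.
move=> e; have : (l ^ 2 %| d)%N by rewrite -(dvdn_pexp2r _ _ (isT : (0 < 2)%N)) e dvdn_mulr.
by move/sqd => l1; rewrite l1 in pl.
Qed.

Section SquareNorm.
Variables a b c d : C.
Hypotheses (det1 : a * d - b * c = 1)
           (Oprod : {in [:: a; b; c; d] &, forall x y, O (x * y)}).
Local Notation E := [:: a; b; c; d].

(* Writing [|x| ^ 2 = t * sqrt D] with [D] squarefree, every [y * conjc y'] is
   [sqrt D] times an algebraic integer, so [1 = `|ad - bc| ^ 2] is [D] times one. *)
Lemma entry_norm_nat x : x \in E -> x != 0 -> exists k : nat, modc x ^+ 2 = k%:R.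
Proof.
move=> xE x0.
have nn y y' : y \in E -> y' \in E -> exists k : nat, modc y ^+ 2 * modc y' ^+ 2 = k%:R.
  move=> yE y'E; rewrite -exprMn -modcM.
  exact/(integers_modc hm)/Oprod.
have [k ek] := nn x x xE xE.
have nx0 : 0 < modc x ^+ 2 by rewrite exprn_gt0 // modc_gt0.
have k0 : (0 < k)%N by rewrite -(ltr0n R) -ek mulr_gt0.
have [D [t [sqD t0 eD]]] := squarefree_part k0.
have D0 := squarefree_gt0 sqD.
pose r : R := Num.sqrt D%:R.
have r0 : 0 < r by rewrite sqrtr_gt0 ltr0n.
have r2 : r ^+ 2 = D%:R by rewrite sqr_sqrtr ?ler0n.
have tR : 0 < t%:R :> R by rewrite ltr0n.
have ex : modc x ^+ 2 = t%:R * r.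
  apply/eqP; rewrite -(eqrXn2 (isT : (0 < 2)%N)) ?ltW // ?mulr_gt0 //.
  by rewrite [X in X == _]expr2 ek eD exprMn r2 natrM natrX mulrC.
have DtQ : (D%:R * t%:R : rat) != 0 by rewrite mulf_neq0 // pnatr_eq0 -lt0n.
have DR : (D%:R : R) != 0 by rewrite pnatr_eq0 -lt0n.
(* |y|^2 / r is rational because |x|^2 |y|^2 is an integer, and D times its square is the integer
   |y|^4; as D is squarefree, it is itself an integer. *)
have norm_y y : y \in E -> exists q : int, modc y ^+ 2 = r * q%:~R.
  move=> yE; have [j ej] := nn x y xE yE; have [l el] := nn y y yE yE.
  pose q : rat := j%:R / (D%:R * t%:R).
  have eq : modc y ^+ 2 = r * ratr q.
    rewrite /q fmorph_div rmorphM /= !ratr_nat -ej ex -r2.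
    by field; rewrite !gt_eqF.
  have [q' eq'] : exists q' : int, q = q'%:~R.
    apply: (@sqf_denom D q l%:Z sqD).
    apply: (fmorph_inj (ratr : {rmorphism rat -> R})).
    rewrite rmorphM rmorphXn /= ratr_nat ratr_int -pmulrn -el eq -r2; ring.
  by exists q'; rewrite eq eq' ratr_int.
have rC0 : r%:C%C != 0 by rewrite -(rmorph0 (real_complex R)) (inj_eq (@complexI R)) gt_eqF.
have rC2 : r%:C%C ^+ 2 = D%:R by rewrite -rmorphXn /= r2 rmorph_nat.
(* Inserting x conj(x) = t r shows that z is in [K]. D times its squared trace is the trace of (y
   conj(y'))^2 plus 2 |y|^2 |y'|^2, an integer, so the rational trace is an integer; the norm is one
   by [norm_y]. *)
have kap y y' : y \in E -> y' \in E -> O (y * conjc y' / r%:C%C).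
  move=> yE y'E; set z := _ / _.
  have conjr : conjc r%:C%C = r%:C%C by rewrite conjc_real.
  have conjz : conjc z = conjc y * y' / r%:C%C.
    by rewrite /z conjcM conjc_inv conjr conjcM conjcK.
  have Kz : K z.
    have -> : z = (y * x) * conjc (y' * x) / (D%:R * t%:R).
      rewrite /z conjcM -rC2.
      have xx : x * conjc x = t%:R * r%:C%C.
        by rewrite -modc_sq ex rmorphM /= rmorph_nat.
      have tC : (t%:R : C) != 0 by rewrite pnatr_eq0 -lt0n.
      transitivity (y * conjc y' * (x * conjc x) / (r%:C%C ^+ 2 * t%:R)).
        by rewrite xx; field; rewrite rC0 tC.
      by field; rewrite rC0 tC.
    apply: quad_fieldM.
      by apply: quad_fieldM; [exact: (Oprod yE xE).1 | exact/quad_field_conj/(Oprod y'E xE).1].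
    by apply/quad_fieldV/quad_fieldM; exact: quad_field_nat.
  have [p eq] : exists p : rat, z + conjc z = ratr p.
    have [p [q ->]] := Kz; exists (p + p).
    by rewrite conj_quad_field rmorphD /=; ring.
  have [k2 ek2] : exists j : int, D%:R * (z + conjc z) ^+ 2 = j%:~R.
    have [j ej] := integers_trace hm (integersM (Oprod yE yE) (integers_conj (Oprod y'E y'E))).
    have [l el] := nn y y' yE y'E.
    exists (j + 2 * l%:Z).
    rewrite rmorphD rmorphM /= -ej -pmulrn.
    have -> : (l%:R : C) = (y * conjc y) * (y' * conjc y').
      by rewrite -!modc_sq -rmorphM /= el rmorph_nat.
    rewrite conjz /z -rC2 !conjcM !conjcK.
    by field.
  have [p' ep'] : exists p' : int, p = p'%:~R.
    apply: (@sqf_denom D p k2 sqD).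
    apply: (fmorph_inj (ratr : {rmorphism rat -> C})).
    by rewrite rmorphM rmorphXn /= ratr_nat ratr_int -eq.
  have [q1 e1] := norm_y y yE; have [q2 e2] := norm_y y' y'E.
  apply: (integers_of_trace_norm (k := p') (l := q1 * q2) Kz).
    by rewrite eq ep' ratr_int.
  have -> : z * conjc z = (y * conjc y) * (y' * conjc y') / r%:C%C ^+ 2.
    by rewrite conjz /z; field.
  rewrite -!modc_sq e1 e2 !rmorphM /= !rmorph_int.
  by field.
have [aE bE cE dE] : [/\ a \in E, b \in E, c \in E & d \in E].
  by rewrite !inE !eqxx ?orbT.
pose kp y y' := y * conjc y' / r%:C%C.
have one : 1 = D%:R * (kp a a * kp d d - kp a b * kp d c - kp b a * kp c d + kp b b * kp c c).
  transitivity ((a * d - b * c) * conjc (a * d - b * c)).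
    by rewrite det1 conjc1 mulr1.
  by rewrite conjcD conjcN !conjcM /kp -rC2; field.
have D1 : D = 1%N.
  apply/eqP; rewrite eqn_leq D0 andbT -(ler_nat R).
  have := congr1 (@modc R) one; rewrite modc1 modcM modc_nat.
  set w := _ + _; move=> e; have Ow : O w.
    by do ![apply: integersD | apply: integersN | exact: kap | apply: integersM].
  have w0 : w != 0.
    apply/eqP => w0; move/eqP: e; rewrite w0 modc0 mulr0 oner_eq0 //.
  by rewrite [leRHS]e ler_peMr // (integers_modc_ge1 hm).
by exists t; rewrite ex /r D1 sqrtr1 mulr1.
Qed.

(* [x ^ 2 (x + conjc x) ^ 2 = (x ^ 2 + |x| ^ 2) ^ 2], and [(x + conjc x) ^ 2] is a
   nonnegative rational integer; when it vanishes, [x ^ 2 = - |x| ^ 2]. *)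
Lemma entry_scaled x : x \in E -> x != 0 ->
  exists2 k : nat, (0 < k)%N & K (k%:sqrt * x).
Proof.
move=> xE x0; have [th eth] := entry_norm_nat xE x0.
have m0 := squarefree_gt0 hm.
have xx : x * conjc x = th%:R by rewrite -modc_sq eth rmorph_nat.
have th0 : (0 < th)%N by rewrite -(ltr0n R) -eth exprn_gt0 // modc_gt0.
have K_sq (y z : C) : y ^+ 2 = z ^+ 2 -> K z -> K y.
  move/eqP; rewrite eqf_sqr => /orP[] /eqP -> //; exact: quad_fieldN.
have [e|ne] := eqVneq (x + conjc x) 0.
  (* Here x^2 = - th, so sqrt(th m) x has the same square as th sqrt(-m). *)
  exists (th * m)%N; first by rewrite muln_gt0 th0.
  apply: (K_sq _ (th%:R * sqrtN R m)).
    have ex2 : x ^+ 2 = - th%:R.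
      have -> : x ^+ 2 = x * (x + conjc x) - x * conjc x by ring.
      by rewrite e xx mulr0 sub0r.
    by rewrite !exprMn natsqrt_sq ex2 sqrtN2 natrM; ring.
  by apply: quad_fieldM; [exact: quad_field_nat | exact: quad_field_sqrtN].
have [j ej] := integers_trace hm (Oprod xE xE).
have sq : (x + conjc x) ^+ 2 = (j + 2 * th%:Z)%:~R.
  by rewrite rmorphD rmorphM /= -ej -pmulrn -xx conjcM; ring.
have pos : 0 < j + 2 * th%:Z.
  have e : x + conjc x = (2 * Re x)%:C%C by rewrite addcJ rmorphM /= rmorph_nat.
  rewrite -(ltr0z R) -ltcR rmorph_int -sq e -rmorphXn ltcR.
  by rewrite exprn_even_gt0 //=; apply: contra ne => /eqP e2; rewrite e e2.
exists (absz (j + 2 * th%:Z)); first by rewrite absz_gt0 gt_eqF.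
apply: (K_sq _ (x ^+ 2 + th%:R)).
  rewrite exprMn natsqrt_sq pmulrn gtz0_abs // -sq -xx; ring.
by apply: quad_fieldD; [exact: (Oprod xE xE).1 | exact: quad_field_nat].
Qed.

End SquareNorm.

(** One nonzero entry x0 with sqrt k x0 in [K] decides the label for all entries, because every x0 y
    is in [K]. The square part of k is absorbed into [K]. *)
Lemma max_ext_scaled (A : 'M[C]_2) : max_ext m A ->
  exists2 d, sqf_divisors (discK m) d & scaled_quad m d A.
Proof.
move=> gA; suff [d sqd KA] : exists2 d, squarefree d & scaled_quad m d A.
  by exists d => //; exact: scaled_quad_disc gA KA.
have [SA OA] := gA.
have [i0 [j0 nz]] := SL2_entry_neq0 SA.
have [k k0 Kk] : exists2 k : nat, (0 < k)%N & K (k%:sqrt * A i0 j0).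
  move: gA nz; have [a [b [c [d ->]]]] := mx2P A => /max_ext_mx2[det1 H].
  apply: entry_scaled det1 H _ _.
  by rewrite mxE !inE; case: ifP => _; case: ifP => _; rewrite eqxx ?orbT.
have [d [t [sqd t0 ek]]] := squarefree_part k0.
have tC : (t%:R : C) != 0 by rewrite pnatr_eq0 -lt0n.
exists d => // i j.
have kt : k%:sqrt = d%:sqrt * t%:R.
  rewrite ek natrM natrX sqrtrM ?ler0n // sqrtr_sqr ger0_norm ?ler0n //.
  by rewrite rmorphM /= rmorph_nat.
have -> : d%:sqrt * A i j =
    (k%:sqrt * A i0 j0) * (A i0 j0 * A i j) / (t%:R * (A i0 j0 * A i0 j0)).
  by rewrite kt; field; rewrite nz tC.
apply: quad_fieldM; first by apply: quad_fieldM => //; exact: (OA _ _ _ _).1.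
apply/quad_fieldV/quad_fieldM; first exact: quad_field_nat.
exact: (OA _ _ _ _).1.
Qed.

(** An element of [max_ext] with label [d] differs from the representative [Vd] with the same label
    by an element of [GammaK]; the converse is closure under multiplication. *)
Lemma max_extE (u v : nat -> int) :
  (forall d, sqf_divisors (discK m) d -> bezout m d (u d) (v d)) ->
  max_ext m = \bigcup_(d in sqf_divisors (discK m))
                rcoset (GammaK m) (Vd R m d (u d) (v d)).
Proof.
move=> uv; apply/seteqP; split=> [A gA | A [d dD [B gB <-]]].
  have [d dD KA] := max_ext_scaled gA; exists d => //.
  apply: scaled_rcoset (squarefree_gt0 dD.2) (Vd_max_ext R hm dD (uv d dD)) gA _ KA.
  exact: Vd_scaled.
apply: (subgroup_mul (max_ext_subgroup R m)); first exact: GammaK_max_ext.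
exact: Vd_max_ext (uv d dD).
Qed.

End Decomposition.

Theorem theorem1 (R : realType) (m : nat) (hm : squarefree m) :
  [/\ forall d : nat, sqf_divisors (discK m) d ->
        [/\ (d %| m ^ 2 + m)%N,
            coprime d ((m ^ 2 + m) %/ d),
            exists u v : int, bezout m d u v,
            forall u v : int, bezout m d u v -> SL2 (Vd R m d u v) &
            forall u v u' v' : int, bezout m d u v -> bezout m d u' v' ->
              rcoset (GammaK m) (Vd R m d u v) =
              rcoset (GammaK m) (Vd R m d u' v')],
      exists! G : set 'M[R[i]]_2, maximal_discrete_extension (GammaK m) G &
      forall GammaKstar : set 'M[R[i]]_2,
        maximal_discrete_extension (GammaK m) GammaKstar ->
      forall u v : nat -> int,
        (forall d : nat, sqf_divisors (discK m) d -> bezout m d (u d) (v d)) ->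
      GammaKstar = \bigcup_(d in sqf_divisors (discK m))
                     rcoset (GammaK m) (Vd R m d (u d) (v d))].
Proof.
split.
- move=> d dD; split.
  + by have [] := sqf_divisors_dvdn hm dD.
  + exact: sqf_divisors_coprime.
  + exact: bezout_exists.
  + by move=> u v; exact: Vd_SL2.
  + move=> u v u' v' uv uv'.
    apply: scaled_rcoset_eq (squarefree_gt0 dD.2) _ _ _ _.
    * exact: Vd_max_ext.
    * exact: Vd_max_ext.
    * exact: Vd_scaled.
    * exact: Vd_scaled.
- exists (max_ext m); split; first exact: max_ext_maximal.
  by move=> G /(maximal_extension_unique hm).
- by move=> G /(maximal_extension_unique hm) -> u v; exact: max_extE.
Qed.
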